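(* The unique global minimum of the functional $$\mathcal{A}\left(\frac{\partial\psi_1(\alpha_0,\alpha_1)}{\partial s},\dots,\frac{\partial\psi_d(\alpha_{d-1},\alpha_d)}{\partial s}\right)=\left\|\frac{\partial}{\partial s}\left[\sum_{\alpha_0,\dots,\alpha_d=1}^{r}\psi_1(\alpha_0,\alpha_1)\psi_2(\alpha_1,\alpha_2)\cdots\psi_d(\alpha_{d-1},\alpha_d)\right]-N(u)\right\|^2_{L^2_\mu(\Omega)}+\sum_{i=1}^{d-1}\sum_{\alpha_i,\beta_i=1}^{r_i}\lambda^{(i)}_{\alpha_i\beta_i}\left\langle\frac{\partial\psi_i(\alpha_{i-1},\alpha_i)}{\partial s},\psi_i(\alpha_{i-1},\beta_i)\right\rangle_{L^2_{\tau\times\mu_i}(\mathbb{N}\times\Omega_i)}$$ is attained at FTT tensor cores satisfying the PDE system $$\frac{\partial\Psi_1}{\partial t}=\left[\left\langle N(u),\Phi_1^T\right\rangle_{2,\dots,d}-\Psi_1\left\langle\left\langle\Psi_1^T,N(u)\right\rangle_1,\Phi_1^T\right\rangle_{2,\dots,d}\right]C_{\Phi_1^T,\Phi_1^T}^{-1},$$ $$\frac{\partial\Psi_k}{\partial t}=\left[\left\langle\left\langle\Psi_{k-1}^T\cdots\Psi_1^T,N(u)\right\rangle_{1,\dots,k-1},\Phi_k^T\right\rangle_{k+1,\dots,d}-\Psi_k\left\langle\left\langle\Psi_k^T\cdots\Psi_1^T,N(u)\right\rangle_{1,\dots,k},\Phi_k^T\right\rangle_{k+1,\dots,d}\right]C_{\Phi_k^T,\Phi_k^T}^{-1},\quad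 k=2,3,\dots,d-1,$$ $$\frac{\partial\Psi_d}{\partial t}=\left\langle\Psi_{d-1}^T\cdots\Psi_1^T,N(u)\right\rangle_{1,\dots,d-1}.$$
   Context: Let $\Omega=\Omega_1\times\cdots\times\Omega_d$ with $\Omega_i=[a_i,b_i]$ real intervals, and let $\mu=\mu_1\times\cdots\times\mu_d$ be a finite product measure on $\Omega$; all spaces are real. $\tau$ denotes the counting measure on $\mathbb{N}$. $M_{p\times q}(L^2_\nu(X))$ denotes the $p\times q$ matrices with entries in $L^2_\nu(X)$. For $\Psi,\tilde\Psi\in M_{p\times q}(L^2_\nu(X))$, $C_{\Psi,\tilde\Psi}=\langle\Psi^T,\tilde\Psi\rangle_{L^2_\nu(X)}$ is the real $q\times q$ matrix with entries $[C_{\Psi,\tilde\Psi}]_{ij}=\sum_{k=1}^{p}\langle\Psi_{ki},\tilde\Psi_{kj}\rangle_{L^2_\nu(X)}$. Fix a rank vector $r=(r_0,r_1,\dots,r_d)$ of positive integers with $r_0=r_d=1$. $V^{(i)}_{r_{i-1}\times r_i}$ is the set of $\Psi_i\in M_{r_{i-1}\times r_i}(L^2_{\mu_i}(\Omega_i))$ such that $C_{\Psi_i,\Psi_i}$ is invertible. $\mathfrak{T}_r^{(d)}$ (the functional tensor train, or FTT, tensors of rank $r$) is the set of $u\in L^2_\mu(\Omega)$ of the form $u=\Psi_1(x_1)\Psi_2(x_2)\cdots\Psi_d(x_d)$ (matrix product) with $\Psi_i\in V^{(i)}_{r_{i-1}\times r_i}$ for all $i=1,\dots,d$. The $\Psi_i$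 are called FTT cores, with entries $[\Psi_i]_{jk}=\psi_i(j,k)$, functions of $x_i$. Consider an autonomous evolution equation $\partial u/\partial t=N(u)$, $u(x,0)=u_0(x)$, where $N$ is a nonlinear operator which may depend on the spatial variables and may incorporate boundary conditions. At a fixed time let $u\in\mathfrak{T}_r^{(d)}$ be written as $u=\Psi_1\cdots\Psi_d$ with $C_{\Psi_i,\Psi_i}=I_{r_i\times r_i}$ for $i=1,\dots,d-1$. Let $s\mapsto\Psi_1(s)\cdots\Psi_d(s)$ denote continuously differentiable curves on $\mathfrak{T}_r^{(d)}$ passing through $u$ at $s=0$; all quantities depending on $s$ are evaluated at $s=0$. The functional $\mathcal{A}$ is the action functional, with Lagrange multipliers $\lambda^{(i)}_{\alpha_i\beta_i}$, for the problem of minimizing over the core velocities $\partial\psi_i(\alpha_{i-1},\alpha_i)/\partial s$ the squared norm appearing as its first term, subject to the constraints $$\left\langle\frac{\partial\psi_i(\alpha_{i-1},\alpha_i)}{\partial s},\psi_i(\alpha_{i-1},\beta_i)\right\rangle_{L^2_{\tau\times\mu_i}(\mathbb{N}\times\Omega_i)}=0,\quad i=1,\dots,d-1,\ \alpha_i,\beta_i=1,\dots,r_i.$$ The inner product over $\mathbb{N}\times\Omega_i$ includes summation over the index $\alpha_{i-1}=1,\dots,r_{i-1}$. In the PDE system the optimal core velocities are written $\partial\Psi_i/\partial t$. $\langle\cdot,\cdot\rangle_{i_1,\dots,i_j}$ denotes the $L^2$ inner product over the variables $x_{i_1},\dots,x_{i_j}$ with respect to $\mu_{i_1}\times\cdots\times\mu_{i_j}$,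 the remaining variables being parameters; for matrix-valued arguments $\langle A,B\rangle_{i_1,\dots,i_j}$ is the matrix obtained by integrating each entry of the product $AB$ over these variables. $\Phi_k$ is the multivariate FTT core in the $k$-th step of the FTT decomposition, i.e. the column vector with components $\varphi_k(\alpha_k;x_{k+1},\dots,x_d)$, $\alpha_k=1,\dots,r_k$, so that $\Phi_k=\Psi_{k+1}\cdots\Psi_d$ and $u=\Psi_1\cdots\Psi_k\Phi_k$; $C_{\Phi_k^T,\Phi_k^T}=\langle\Phi_k,\Phi_k^T\rangle_{k+1,\dots,d}\in\mathbb{R}^{r_k\times r_k}$.
   Formalization: Invertibility of C_{Φ_k^T,Φ_k^T} (k=1,…,d−1) is added: it does not follow from u∈T_r (e.g. Ψ_d=(1,0)^T), and otherwise the inverse is undefined and uniqueness fails. Also N(u)∈L²_μ and d≥2 are assumed; uniqueness is among velocities meeting the constraints. *)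

(* Defs.v *)
From HB Require Import structures.
From mathcomp Require Import all_boot all_order all_algebra.
From mathcomp Require Import all_classical all_reals all_analysis.
Import Order.TTheory GRing.Theory Num.Theory.
Import numFieldTopology.Exports.
Set Implicit Arguments.
Unset Strict Implicit.
Unset Printing Implicit Defensive.

Local Open Scope classical_set_scope.
Local Open Scope ring_scope.

(* A point (x_1, ..., x_d) is a d.-tuple R, a function of x_i in [a_i, b_i] is
   a function on R, and mu_i is a finite Borel measure on R that vanishes
   outside [a_i, b_i]: L2 classes over R and over [a_i, b_i] then coincide.
   Variables, measures and cores are numbered from 0 and indexed by nat; only
   the indices i < d matter.  Elements of L2 are represented by functions, so
   equality of elements of L2 is equality almost everywhere. *)

Section ConsMeasure.
Context (R : realType) (n : nat).
Variables (m1 : {finite_measure set R -> \bar R})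
          (m2 : {finite_measure set (n.-tuple R) -> \bar R}).
Local Open Scope ereal_scope.

Definition cons_pt (p : R * n.-tuple R) : n.+1.-tuple R := [tuple of p.1 :: p.2].

Definition cons_measure : set (n.+1.-tuple R) -> \bar R :=
  pushforward (m1 \x m2) cons_pt.

Let measurable_cons_pt : measurable_fun setT cons_pt.
Proof. exact: measurable_cons measurable_fst measurable_snd. Qed.

Let cons0 : cons_measure set0 = 0.
Proof. by rewrite /cons_measure /pushforward preimage_set0 measure0. Qed.

Let cons_ge0 A : 0 <= cons_measure A.
Proof. exact: measure_ge0. Qed.

Let cons_additive : semi_sigma_additive cons_measure.
Proof.
exact: (@measure_semi_sigma_additive _ _ _
  (measure_function_pushforward__canonical__measure_function_Measure
    (m1 \x m2) measurable_cons_pt)).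
Qed.

HB.instance Definition _ := isMeasure.Build _ _ _ cons_measure
  cons0 cons_ge0 cons_additive.

Let cons_finite : fin_num_fun cons_measure.
Proof.
apply: lty_fin_num_fun => /=.
rewrite [ltLHS](_ : _ = (m1 \x m2) (setT `*` setT)); last by rewrite setXTT.
rewrite product_measure1E//.
by apply: lte_mul_pinfty; rewrite ?fin_num_measure// -ge0_fin_numE// fin_num_measure.
Qed.

HB.instance Definition _ :=
  Measure_isFinite.Build _ _ _ cons_measure cons_finite.

End ConsMeasure.

(* mu_0 x ... x mu_(n-1); see prod_measure_box. *)
Fixpoint prod_measure (R : realType) (n : nat)
    (mu : nat -> {finite_measure set R -> \bar R}) :
    {finite_measure set (n.-tuple R) -> \bar R} :=
  match n with
  | 0%N => \d_[tuple]
  | m.+1 => cons_measure (mu 0%N) (prod_measure m (fun i => mu i.+1))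
  end.

Lemma prod_measure_box (R : realType) (n : nat)
    (mu : nat -> {finite_measure set R -> \bar R}) (A : nat -> set R) :
  (forall i, measurable (A i)) ->
  prod_measure n mu [set x | forall i, (i < n)%N -> A i x`_i] =
  (\prod_(i < n) mu i (A i))%E.
Proof.
elim: n mu A => [|n IHn] mu A mA.
  rewrite big_ord0 /= diracE mem_set//.
rewrite big_ord_recl /= -(IHn (fun i => mu i.+1) (fun i => A i.+1))//.
rewrite /cons_measure /pushforward -product_measure1E//.
  congr (_ _); apply/seteqP; split => [[y x] /= H|[y x] /= [H0 H] [|i]//= /H//].
  by split=> [|i ?]; [exact: (H 0%N)|exact: (H i.+1)].
have mt (i : 'I_n) : measurable [set x : n.-tuple R | A i.+1 (tnth x i)].
  by rewrite -[X in measurable X]setTI; exact: measurable_tnth.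
rewrite [X in measurable X](_ : _ = \big[setI/setT]_(i < n)
   [set x : n.-tuple R | A i.+1 (tnth x i)]); last first.
  rewrite -bigcap_seq; apply/seteqP; split=> [x /= H i _ /=|x /= H i i_n].
    by rewrite (tnth_nth 0); exact: H.
  by have := H (Ordinal i_n) (mem_index_enum _); rewrite /= (tnth_nth 0).
by apply: bigsetI_measurable.
Qed.

Section L2.
Context d (T : measurableType d) (R : realType).
Variable nu : {measure set T -> \bar R}.
Implicit Types f g : T -> R.

Definition L2ip f g : R := \int[nu]_x (f x * g x).

Definition L2norm f : R := fine 'N[nu]_2[EFin \o f]%E.

(* g is the derivative at s, in the L2 norm, of the curve c *)
Definition is_L2derive (c : R -> T -> R) (s : R) g : Prop :=
  g \in Lfun nu 2 /\
  'N[nu]_2[EFin \o (fun x => h^-1 * (c (s + h) x - c s x) - g x)%R]%E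
    @[h --> 0^'] --> 0%E.

Definition L2derivable (c : R -> T -> R) (s : R) : Prop :=
  exists g, is_L2derive c s g.

(* 0 when c is not differentiable at s *)
Definition L2derive (c : R -> T -> R) (s : R) : T -> R :=
  xget (cst 0) [set g | is_L2derive c s g].

Definition L2_C1_near0 (c : R -> T -> R) : Prop :=
  \forall s \near (0 : R), [/\ c s \in Lfun nu 2, L2derivable c s &
    'N[nu]_2[EFin \o (fun x => L2derive c t x - L2derive c s x)%R]%E
      @[t --> s] --> 0%E].

(* The matrix C_{A, B} = <A^T, B> *)
Definition Cmx p q (A B : T -> 'M[R]_(p, q)) : 'M[R]_q :=
  \matrix_(i, j) \sum_(k < p) L2ip (fun x => A x k i) (fun x => B x k j).

(* The set V_{p x q} of cores *)
Definition is_core p q (A : T -> 'M[R]_(p, q)) : Prop :=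
  (forall i j, (fun x => A x i j) \in Lfun nu 2) /\ Cmx A A \in unitmx.

End L2.

Section FTT.
Context (R : realType) (d : nat) (r : nat -> nat).
Variable mu : nat -> {finite_measure set R -> \bar R}.

Notation Omega := (d.-tuple R).

(* Core i, from 0 to d - 1, is Psi_(i+1) in M_{r_i x r_(i+1)}. *)
Definition cores := forall i : nat, R -> 'M[R]_(r i, r i.+1).

(* <f>_S: the integral of f over the variables x_i with i in S, the others
   being parameters.  These are frozen by the Dirac mass at their value. *)
Definition pint (S : pred nat) (f : Omega -> R) : Omega -> R := fun x =>
  \int[prod_measure d (fun i => if S i then mu i
         else (\d_(x`_i) : {finite_measure set R -> \bar R}))]_z f z.

(* <A, B>_S *)
Definition pintmx p q l (S : pred nat) (A : Omega -> 'M[R]_(p, q))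
    (B : Omega -> 'M[R]_(q, l)) : Omega -> 'M[R]_(p, l) := fun x =>
  \matrix_(i, j) pint S (fun z => (A z *m B z) i j) x.

(* Psi_1 ... Psi_k *)
Fixpoint lprod (Psi : cores) (k : nat) (x : Omega) : 'M[R]_(r 0%N, r k) :=
  match k with
  | 0%N => 1%:M
  | m.+1 => lprod Psi m x *m Psi m x`_m
  end.

(* The product of the m cores Psi_(k+1), Psi_(k+2), ...; used only when
   m + k = d, so that pid_mx, at m = 0 and k = d, is the identity of size r_d *)
Fixpoint rprod (Psi : cores) (m k : nat) (x : Omega) : 'M[R]_(r k, r d) :=
  match m with
  | 0%N => pid_mx (r d)
  | m'.+1 => Psi k x`_k *m rprod Psi m' k.+1 x
  end.

(* Phi_k = Psi_(k+1) ... Psi_d *)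
Definition Phi (Psi : cores) (k : nat) := rprod Psi (d - k) k.

(* The sum over alpha_0, ..., alpha_d; alpha_0 and alpha_d range over
   r_0 = r_d = 1 values. *)
Definition ftt (Psi : cores) : Omega -> R := fun x =>
  \sum_(i < r 0%N) \sum_(j < r d) lprod Psi d x i j.

(* C_{Phi_k^T, Phi_k^T}; the value does not depend on x. *)
Definition CPhi (Psi : cores) (k : nat) (x : Omega) : 'M[R]_(r k) :=
  pintmx (fun i => (k <= i)%N) (Phi Psi k) (fun z => (Phi Psi k z)^T) x.

(* u is in T_r, with cores Psi *)
Definition ftt_decomp (u : Omega -> R) (Psi : cores) : Prop :=
  [/\ u \in Lfun (prod_measure d mu) 2,
      forall i, (i < d)%N -> is_core (mu i) (Psi i) &
      u = ftt Psi %[ae prod_measure d mu]].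

Definition cores_aeq (A B : cores) : Prop :=
  forall i, (i < d)%N -> A i = B i %[ae mu i].

(* s |-> P s is, near s = 0, a continuously differentiable curve of cores of
   elements of T_r; it passes through Psi at s = 0. *)
Definition ftt_curve (Psi : cores) (P : R -> cores) : Prop :=
  [/\ cores_aeq (P 0) Psi,
      \forall s \near (0 : R), ftt_decomp (ftt (P s)) (P s) &
      forall i, (i < d)%N -> forall j k,
        L2_C1_near0 (mu i) (fun s y => P s i y j k)].

(* The derivative of the cores at s = 0 *)
Definition velocity (P : R -> cores) : cores := fun i y =>
  \matrix_(j, k) L2derive (mu i) (fun s y => P s i y j k) 0 y.

(* <d psi_i(alpha_(i-1), alpha_i)/ds, psi_i(alpha_(i-1), beta_i)>, with the
   summation over alpha_(i-1) that the product over N x Omega_i includes *)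
Definition gauge_ip (P : R -> cores) (i : nat) : 'M[R]_(r i.+1) :=
  Cmx (mu i) (velocity P i) (P 0 i).

Definition gauge (P : R -> cores) : Prop :=
  forall i, (i.+1 < d)%N -> forall j k, gauge_ip P i j k = 0.

Definition action (Nu : Omega -> R) (lam : forall i : nat, 'M[R]_(r i.+1))
    (P : R -> cores) : R :=
  L2norm (prod_measure d mu) (fun x =>
    L2derive (prod_measure d mu) (fun s => ftt (P s)) 0 x - Nu x) ^+ 2
  + \sum_(i < d.-1) \sum_(j < r i.+1) \sum_(k < r i.+1)
      lam i j k * gauge_ip P i j k.

(* <<Psi_k^T ... Psi_1^T, Nu>_{1, ..., k}, Phi_l^T>_{l+1, ..., d}.  The scalar
   Nu is a matrix of size r_0 x r_d = 1 x 1. *)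
Definition pair_lr (Nu : Omega -> R) (Psi : cores) (k l : nat) :
    Omega -> 'M[R]_(r k, r l) :=
  pintmx (fun i => (l <= i)%N)
    (pintmx (fun i => (i < k)%N) (fun z => (lprod Psi k z)^T)
       (fun z => const_mx (Nu z) : 'M[R]_(r 0%N, r d)))
    (fun z => (Phi Psi l z)^T).

(* The PDE system, with dPsi/dt = V.  The right-hand sides are functions on
   Omega that depend on x_k only, and equation k is an equality at y = x_k. *)
Definition pde_system (Nu : Omega -> R) (Psi V : cores) : Prop :=
  [/\ {ae mu 0%N, forall y, forall x : Omega, x`_0 = y ->
        V 0%N y =
        (pintmx (fun i => (1 <= i)%N)
           (fun z => const_mx (Nu z) : 'M[R]_(r 0%N, r d))
           (fun z => (Phi Psi 1 z)^T) x
         - Psi 0%N y *m pair_lr Nu Psi 1 1 x) *m invmx (CPhi Psi 1 x)},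
      forall k, (0 < k)%N -> (k.+1 < d)%N ->
        {ae mu k, forall y, forall x : Omega, x`_k = y ->
          V k y =
          (pair_lr Nu Psi k k.+1 x - Psi k y *m pair_lr Nu Psi k.+1 k.+1 x)
            *m invmx (CPhi Psi k.+1 x)} &
      {ae mu d.-1, forall y, forall x : Omega, x`_d.-1 = y ->
        V d.-1 y =
        pintmx (fun i => (i < d.-1)%N) (fun z => (lprod Psi d.-1 z)^T)
          (fun z => const_mx (Nu z) : 'M[R]_(r 0%N, r d.-1.+1)) x}].

End FTT.

(* Main.v *)
Require Import Defs.
From mathcomp Require Import all_boot all_order all_algebra.
From mathcomp Require Import all_classical all_reals all_analysis.
From mathcomp Require Import measurable_realfun.
From mathcomp Require Import ring lra.
Import Order.TTheory GRing.Theory Num.Theory.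
Import numFieldTopology.Exports.

(* Let V be the right-hand side of the PDE system and D W the derivative of
   Psi_1 ... Psi_d along core velocities W, a sum of d terms with one core each
   replaced by W_k.  The left products are orthonormal, so for gauged W these
   terms are pairwise orthogonal, and the k-th one has squared norm
   tr (<W_k^T, W_k> C_{Phi_k}): D is injective on gauged velocities.  For F in
   L2, <F, D W> is the sum over k of the scalar products of W_k with a function
   T_k(F) of x_k alone, obtained from F by integrating out the other variables.
   As V_k C_{Phi_k} = T_k(N(u)) - Psi_k <Psi_k^T, T_k(N(u))>, the residual
   e = D V - N(u) is orthogonal to D W for every gauged W, and Pythagoras' identity
   |D W - N(u)|^2 = |e|^2 + |D (W - V)|^2 gives the unique minimum under the gauge.
   An arbitrary W differs from a gauged one by the Psi_k <Psi_k^T, W_k>, whose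
   first-order contribution the multipliers -2 <T_k(e)^T, Psi_k> cancel.  The
   minimum is attained along the affine curve Psi + s V. *)

Set Implicit Arguments.
Unset Strict Implicit.
Unset Printing Implicit Defensive.
Local Open Scope classical_set_scope.
Local Open Scope ring_scope.

(** * Product measures and partial integrals *)

Section ProdMeasure.
Context (R : realType).
Implicit Types (n : nat) (S : pred nat) (mu nu : nat -> {finite_measure set R -> \bar R}).

(** Partial integrals are defined pointwise for every function, so nothing says beforehand that
    [T_k(F)] is square integrable; this comes by duality, from a bound on its pairing with the L2
    functions of [x_k]. Products of cores join functions of disjoint sets of variables, for which L2
    norms multiply; this takes the place of boundedness, in the product rule in particular. A curve
    takes the value [Psi] at 0 only almost everywhere, lies in L2 only near 0, and its derivative is
    a chosen representative; derivatives are therefore handled by a relation in which base value and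
    derivative are separate data. Orthonormality holds on the left only, whence the Gram matrices of
    the [Phi_k] and their inverses. The last equation has no inverse because the empty right product
    is 1, and no projection because the gauge leaves the last core free. Uniqueness is claimed under
    the gauge only: adding [Psi_k G] to one core velocity and subtracting [G Psi_(k+1)] from the
    next one leaves [D W] unchanged. *)

Lemma measurable_cons_pt n :
  measurable_fun [set: R * n.-tuple R] (@cons_pt R n).
Proof. exact: measurable_cons measurable_fst measurable_snd. Qed.

Lemma tonelli_cons n mu (f : n.+1.-tuple R -> \bar R) :
  measurable_fun setT f -> (forall x, 0 <= f x)%E ->
  (\int[prod_measure n.+1 mu]_x f x =
   \int[mu 0%N]_y \int[prod_measure n (fun i => mu i.+1)]_z
      f [tuple of y :: z])%E.
Proof.
move=> mf f0.
transitivity (\int[mu 0%N \x prod_measure n (fun i => mu i.+1)]_p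
   f (cons_pt p))%E.
  rewrite -(@ge0_integral_pushforward _ _ _ _ _ _ (@measurable_cons_pt n)
    (mu 0%N \x prod_measure n (fun i => mu i.+1))%E setT f)//.
rewrite fubini_tonelli1//.
by apply: measurableT_comp => //; exact: measurable_cons_pt.
Qed.

Lemma eq_prod_measure n mu nu : (forall i, (i < n)%N -> mu i = nu i) ->
  prod_measure n mu = prod_measure n nu.
Proof.
elim: n mu nu => [//|n IHn] mu nu h /=.
by rewrite h// (IHn _ (fun i => nu i.+1))// => i ?; exact: h.
Qed.

Lemma measurable_nth n k : (k < n)%N ->
  measurable_fun [set: n.-tuple R] (fun x : n.-tuple R => x`_k).
Proof.
move=> kn; rewrite (_ : (fun _ => _) = @tnth n R ^~ (Ordinal kn)).
  exact: measurable_tnth.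
by apply/funext => x; rewrite (tnth_nth 0).
Qed.

Lemma measurable_tupleP d (T : measurableType d) n (f : T -> n.-tuple R) :
  (forall i, (i < n)%N -> measurable_fun [set: T] (fun x => (f x)`_i)) ->
  measurable_fun [set: T] f.
Proof.
move=> h; apply/measurable_fun_tnthP => i.
rewrite (_ : _ \o _ = fun x => (f x)`_i); first exact: h.
by apply/funext => x /=; rewrite (tnth_nth 0).
Qed.

(** Glues two points along a set of variables, so that integrating out some variables is an integral
    over whole points and no type of partial points is needed. *)
Definition splice n (S : pred nat) (w x : n.-tuple R) : n.-tuple R :=
  [tuple if S i then w`_i else x`_i | i < n].

Lemma nth_splice n S (w x : n.-tuple R) i : (i < n)%N ->
  (splice S w x)`_i = if S i then w`_i else x`_i.
Proof.
by move=> i_n; rewrite -[i]/(nat_of_ord (Ordinal i_n)) -tnth_nth tnth_mktuple.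
Qed.

Lemma eq_nthT n (x y : n.-tuple R) :
  (forall i, (i < n)%N -> x`_i = y`_i) -> x = y.
Proof.
by move=> h; apply: eq_from_tnth => i; rewrite !(tnth_nth 0); exact: h.
Qed.

Lemma splice_cons n S (w x : n.-tuple R) (v y : R) :
  splice S [tuple of v :: w] [tuple of y :: x] =
  [tuple of (if S 0%N then v else y) :: splice (fun i => S i.+1) w x].
Proof.
apply: eq_nthT => -[|i] i_n; rewrite nth_splice//=.
by rewrite -[RHS]/((splice (fun i => S i.+1) w x)`_i) nth_splice.
Qed.

Lemma measurable_splice d (T : measurableType d) n S (f g : T -> n.-tuple R) :
  measurable_fun [set: T] f -> measurable_fun [set: T] g ->
  measurable_fun [set: T] (fun t => splice S (f t) (g t)).
Proof.
move=> mf mg; apply: measurable_tupleP => i i_n.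
rewrite (_ : (fun _ => _) = fun t => if S i then (f t)`_i else (g t)`_i).
  case: (S i).
    exact: (measurableT_comp (f := fun x : n.-tuple R => x`_i) (measurable_nth i_n) mf).
  exact: (measurableT_comp (f := fun x : n.-tuple R => x`_i) (measurable_nth i_n) mg).
by apply/funext => t; rewrite nth_splice.
Qed.

Lemma measurable_splice2 n S :
  measurable_fun [set: n.-tuple R * n.-tuple R] (fun p => splice S p.2 p.1).
Proof. exact: measurable_splice. Qed.

(** Gluing discards the coordinates of [x] in [S] and those of [w] outside [S]; the measures of
    these discarded coordinates have mass 1, so each integrates out to a factor 1. *)
Lemma tonelli_splice n S nu1 nu2 (f : n.-tuple R -> \bar R) :
  (forall i, S i -> nu1 i setT = 1%E) ->
  (forall i, ~~ S i -> nu2 i setT = 1%E) ->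
  measurable_fun setT f -> (forall x, 0 <= f x)%E ->
  (\int[prod_measure n (fun i => if S i then nu2 i else nu1 i)]_x f x =
   \int[prod_measure n nu1]_x \int[prod_measure n nu2]_w f (splice S w x))%E.
Proof.
elim: n S nu1 nu2 f => [|n IHn] S nu1 nu2 f h1 h2 mf f0.
  have fE (x : 0.-tuple R) : f x = f [tuple] by congr f; exact: eq_nthT.
  have int0 (h : 0.-tuple R -> \bar R) : (forall x, h x = f [tuple]) ->
      (\int[\d_([tuple] : 0.-tuple R)]_x h x = f [tuple])%E.
    move=> hE; under eq_integral do rewrite hE.
    by rewrite integral_cst//= diracE mem_set// mule1.
  by rewrite /= !int0// => x; rewrite int0.
pose S' i := S i.+1; pose nu1' i := nu1 i.+1; pose nu2' i := nu2 i.+1.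
have IH y : (\int[prod_measure n (fun i => if S' i then nu2' i else nu1' i)]_z
      f [tuple of y :: z] = \int[prod_measure n nu1']_x
      \int[prod_measure n nu2']_w f [tuple of y :: splice S' w x])%E.
  apply: (IHn S' nu1' nu2' (fun z => f [tuple of y :: z])) => //.
  - by move=> i; exact: h1.
  - by move=> i; exact: h2.
  - by apply: measurableT_comp => //; exact: measurable_cons.
rewrite tonelli_cons//; under eq_integral do rewrite IH.
pose F x := (\int[prod_measure n.+1 nu2]_w f (splice S w x))%E.
have mF : measurable_fun setT F.
  apply: (measurable_fun_fubini_tonelli_F (fun p => f (splice S p.2 p.1))) => //.
  by apply: measurableT_comp => //; exact: measurable_splice2.
rewrite -[RHS]/(\int[prod_measure n.+1 nu1]_x F x)%E tonelli_cons//; last first.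
  by move=> x; exact: integral_ge0.
pose G v y x' := (\int[prod_measure n nu2']_w'
   f [tuple of (if S 0%N then v else y) :: splice S' w' x'])%E.
have FE y (x' : n.-tuple R) : F [tuple of y :: x'] = (\int[nu2 0%N]_v G v y x')%E.
  rewrite /F (@tonelli_cons n nu2 (fun w => f (splice S w [tuple of y :: x']))).
- apply: eq_integral => v _; apply: eq_integral => w' _.
  by rewrite splice_cons.
- apply: measurableT_comp => //.
  by apply: measurable_splice => //; exact: measurable_cst.
- by move=> w; exact: f0.
have G0 v y (x' : n.-tuple R) : (0 <= G v y x')%E by exact: integral_ge0.
under [RHS]eq_integral do under eq_integral do rewrite FE.
have intcst (m : {finite_measure set R -> \bar R}) c :
    (m setT = 1 -> \int[m]_t (fun=> c) t = c)%E.
  by move=> m1; rewrite integral_cst// [X in (_ * X)%E]m1 mule1.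
(* If the head lies in [S], the variable [y] is discarded and the integrals over [v] and [x'] must
   be exchanged; otherwise [v] is discarded and the two sides agree as they stand. *)
rewrite /G; case: ifPn => S0.
  rewrite intcst; last exact: h1.
  rewrite (fubini_tonelli (fun p : n.-tuple R * R => \int[prod_measure n nu2']_w'
    f [tuple of p.2 :: splice S' w' p.1])%E) => //.
    apply: (measurable_fun_fubini_tonelli_F 
      (fun p : (n.-tuple R * R) * n.-tuple R => f [tuple of p.1.2 :: splice S' p.2 p.1.1])) => //.
    apply: measurableT_comp => //; apply: measurable_cons.
      exact: measurableT_comp.
    by apply: measurable_splice => //; exact: measurableT_comp.
  by move=> p; exact: integral_ge0.
apply: eq_integral => y _; apply: eq_integral => x' _.
by rewrite intcst//; exact: h2.
Qed.
End ProdMeasure.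

(** * Change of variables, from an identity between integrals of nonnegative functions *)

Section Transport.
Context d1 d2 (T1 : measurableType d1) (T2 : measurableType d2) (R : realType).
Variables (m1 : {measure set T1 -> \bar R}) (m2 : {measure set T2 -> \bar R}).
Variable phi : T1 -> T2.
Hypothesis mphi : measurable_fun [set: T1] phi.
Hypothesis tr : forall f : T2 -> \bar R, measurable_fun [set: T2] f ->
  (forall x, 0 <= f x)%E ->
  (\int[m2]_x f x = \int[m1]_x f (phi x))%E.

(** Positive and negative parts are transported separately, so the identity holds for all measurable
    functions, integrable or not. *)
Lemma integral_transport (f : T2 -> \bar R) : measurable_fun [set: T2] f ->
  (\int[m2]_x f x = \int[m1]_x f (phi x))%E.
Proof.
move=> mf; rewrite -[RHS]/(\int[m1]_x (f \o phi) x)%E integralE [RHS]integralE.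
rewrite [in RHS]funepos_comp [in RHS]funeneg_comp.
congr (_ - _)%E; apply: tr => //.
- exact: measurable_funepos.
- exact: measurable_funeneg.
Qed.

Lemma Rintegral_transport (f : T2 -> R) : measurable_fun [set: T2] f ->
  \int[m2]_x f x = \int[m1]_x f (phi x).
Proof.
move=> mf; congr fine; apply: (integral_transport (f := EFin \o f)).
exact/measurable_EFinP.
Qed.

Lemma integrable_transport (f : T2 -> R) : measurable_fun [set: T2] f ->
  m2.-integrable [set: T2] (EFin \o f) <->
  m1.-integrable [set: T1] (EFin \o (fun x => f (phi x))).
Proof.
move=> mf; split=> /integrableP[_ i]; apply/integrableP; split.
- by apply/measurable_EFinP; exact: measurableT_comp mf mphi.
- rewrite (le_lt_trans _ i)// (tr (f := fun x => `|(f x)%:E|%E))//.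
  by apply: measurableT_comp => //; exact/measurable_EFinP.
- exact/measurable_EFinP.
- rewrite (le_lt_trans _ i)// (tr (f := fun x => `|(f x)%:E|%E))//.
  by apply: measurableT_comp => //; exact/measurable_EFinP.
Qed.

End Transport.

(** * Partial integrals and Fubini's theorem for sets of variables *)

Section PartialMeasure.
Context (R : realType) (d : nat) (mu : nat -> {finite_measure set R -> \bar R}).
Implicit Types S U V : pred nat.
Local Notation Omega := (d.-tuple R).

(* mu_i integrates the variables in [S]; the others are frozen at 0, so that all
   partial integrals live on the same type of points. *)
Definition pm S : {finite_measure set Omega -> \bar R} :=
  prod_measure d (fun i => if S i then mu i
    else (\d_(0 : R) : {finite_measure set R -> \bar R})).

Lemma eq_pm S V : (forall i, (i < d)%N -> S i = V i) -> pm S = pm V.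
Proof.
by move=> SV; apply: eq_prod_measure => i i_d; rewrite SV.
Qed.

Lemma diracT_eq1 (y : R) :
  ((\d_y : {finite_measure set R -> \bar R}) [set: R] = 1)%E.
Proof.
by rewrite /= diracE mem_set.
Qed.

Lemma pmT : pm xpredT = prod_measure d mu.
Proof.
exact: eq_prod_measure.
Qed.

Lemma integral_prod_dirac n (x : nat -> R) (y : n.-tuple R) (f : n.-tuple R -> \bar R) :
  (forall i, (i < n)%N -> x i = y`_i) ->
  measurable_fun setT f -> (forall x, 0 <= f x)%E ->
  (\int[prod_measure n (fun i => \d_(x i) : {finite_measure set R -> \bar R})]_z f z
   = f y)%E.
Proof.
elim: n x y f => [|n IHn] x y f xy mf f0.
  have fE (z : 0.-tuple R) : f z = f y by congr f; exact: eq_nthT.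
  under eq_integral do rewrite fE.
  by rewrite integral_cst//= diracE mem_set// mule1.
rewrite tonelli_cons// integral_dirac//=; last first.
  apply: (measurable_fun_fubini_tonelli_F (fun p : R * n.-tuple R => f [tuple of p.1 :: p.2])) => //.
  apply: measurableT_comp => //; exact: measurable_cons.
rewrite diracE mem_set// mul1e (IHn (fun i => x i.+1) [tuple of behead y])//.
- congr f; apply: eq_nthT => -[|i] i_n /=; first by rewrite xy.
  by rewrite nth_behead.
- by move=> i i_n; rewrite xy// nth_behead.
- by apply: measurableT_comp => //; exact: measurable_cons.
Qed.

(** Moves the parameter [x] from the measure, where Dirac masses carry it, into the integrand. The
    measure then no longer varies with [x], and Fubini's theorem applies. *)
Lemma tonelli_pint S (x : Omega) (f : Omega -> \bar R) :
  measurable_fun setT f -> (forall x, 0 <= f x)%E ->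
  (\int[prod_measure d (fun i => if S i then mu i
         else (\d_(x`_i) : {finite_measure set R -> \bar R}))]_z f z =
   \int[pm S]_w f (splice S w x))%E.
Proof.
move=> mf f0.
(* The repeated test on [S i] exhibits the factors of [pm S] as the second family of measures in
   [tonelli_splice]. *)
rewrite (@eq_prod_measure _ _ _ (fun i => if S i then
    (if S i then mu i else (\d_(0 : R) : {finite_measure set R -> \bar R}))
    else (\d_(x`_i) : {finite_measure set R -> \bar R}))); last first.
  by move=> i _; case: (S i).
rewrite tonelli_splice//; last 2 first.
- by move=> i _; exact: diracT_eq1.
- by move=> i /negbTE ->; exact: diracT_eq1.
rewrite (@integral_prod_dirac _ _ x)//.
  apply: (measurable_fun_fubini_tonelli_F (fun p => f (splice S p.2 p.1))) => //.
  by apply: measurableT_comp => //; exact: measurable_splice2.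
by move=> y; exact: integral_ge0.
Qed.

Lemma pint_splice S (f : Omega -> R) x : measurable_fun setT f ->
  pint mu S f x = \int[pm S]_w f (splice S w x).
Proof.
apply: Rintegral_transport => g mg g0; exact: tonelli_pint.
Qed.

Lemma tonelli_pm U S V (f : Omega -> \bar R) :
  (forall i, (i < d)%N -> U i = S i || V i) -> (forall i, S i -> ~~ V i) ->
  measurable_fun setT f -> (forall x, 0 <= f x)%E ->
  (\int[pm U]_x f x = \int[pm V \x pm S]_p f (splice S p.2 p.1))%E.
Proof.
move=> USV SV mf f0.
rewrite /pm (@eq_prod_measure _ _ _ (fun i => if S i then
    (if S i then mu i else (\d_(0 : R) : {finite_measure set R -> \bar R}))
    else (if V i then mu i else (\d_(0 : R) : {finite_measure set R -> \bar R}))));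
  last by move=> i i_d; rewrite USV//; case: (S i).
rewrite tonelli_splice//; last 2 first.
- by move=> i /SV/negbTE ->; exact: diracT_eq1.
- by move=> i /negbTE ->; exact: diracT_eq1.
rewrite (fubini_tonelli1 (fun p => f (splice S p.2 p.1)))//.
by apply: measurableT_comp => //; exact: measurable_splice2.
Qed.

(** By Tonelli's theorem the integrals of the positive and of the negative part are measurable in
    the parameter; their difference is measurable even at parameters where the section of [f] is not
    integrable. *)
Lemma measurable_pint S (f : Omega -> R) : measurable_fun setT f ->
  measurable_fun [set: Omega] (pint mu S f).
Proof.
move=> mf; rewrite (_ : pint mu S f = fun x => \int[pm S]_w f (splice S w x)).
  apply: measurableT_comp => //.
  rewrite (_ : (fun _ => _) = fun x =>
    (\int[pm S]_w (EFin \o f)^\+ (splice S w x) -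
     \int[pm S]_w (EFin \o f)^\- (splice S w x))%E).
    apply: emeasurable_funB.
    - apply: (measurable_fun_fubini_tonelli_F
        (fun p => (EFin \o f)^\+ (splice S p.2 p.1))%E) => //.
      apply: measurableT_comp; last exact: measurable_splice2.
      by apply: measurable_funepos; exact/measurable_EFinP.
    - apply: (measurable_fun_fubini_tonelli_F
        (fun p => (EFin \o f)^\- (splice S p.2 p.1))%E) => //.
      apply: measurableT_comp; last exact: measurable_splice2.
      by apply: measurable_funeneg; exact/measurable_EFinP.
  apply/funext => x.
  rewrite -[LHS]/(\int[pm S]_w ((EFin \o f) \o (splice S ^~ x)) w)%E integralE.
  by rewrite [in LHS]funepos_comp [in LHS]funeneg_comp.
by apply/funext => x; exact: pint_splice.
Qed.

Section Pull.
Variables (U S V : pred nat).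
Hypothesis USV : forall i, (i < d)%N -> U i = S i || V i.
Hypothesis SV : forall i, S i -> ~~ V i.
Variables f g : Omega -> R.
Hypotheses (mf : measurable_fun setT f)
  (mg : measurable_fun [set: Omega] g).
Hypothesis gS : forall w x, g (splice S w x) = g x.
Hypothesis ifg : (pm U).-integrable setT (EFin \o (fun x => f x * g x)).

Let mfg : measurable_fun [set: Omega] (fun x => f x * g x).
Proof.
exact: measurable_funM.
Qed.

Let i2 : (pm V \x pm S)%E.-integrable setT
  (EFin \o (fun p => f (splice S p.2 p.1) * g (splice S p.2 p.1))).
Proof.
exact: (integrable_transport (measurable_splice2 _)
  (fun h mh h0 => tonelli_pm USV SV mh h0) mfg).1.
Qed.

Let F (x : Omega) : \bar R := (\int[pm S]_w (f (splice S w x) * g x)%:E)%E.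

Let FE : F = fubini_F (pm S)
  (EFin \o (fun p => f (splice S p.2 p.1) * g (splice S p.2 p.1))).
Proof.
by apply/funext => x; apply: eq_integral => w _ /=; rewrite gS.
Qed.

Let ae_F : ae_eq (pm V) setT (EFin \o (fun x => pint mu S f x * g x)) F.
Proof.
have := ae_integrable1 i2; apply: filterS => x /= ix _.
rewrite pint_splice// /F.
(* Only [f * g] is known to be integrable. Where [g x] vanishes, the section of [f] may fail to be
   integrable, but both sides are 0; elsewhere it is integrable after division by the constant
   [g x]. *)
have [g0|g0] := eqVneq (g x) 0.
  by rewrite g0 mulr0; under eq_integral do rewrite mulr0; rewrite integral0.
have ifx : (pm S).-integrable setT (EFin \o (fun w => f (splice S w x))).
  have := integrableZl measurableT (g x)^-1 ix.
  apply: eq_integrable => // w _ /=; rewrite gS -EFinM; congr EFin.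
  by rewrite mulrCA mulVf ?mulr1.
under [RHS]eq_integral do rewrite EFinM.
rewrite integralZr// /Rintegral EFinM fineK//.
exact: integrable_fin_num.
Qed.

Let iF : (pm V).-integrable setT F.
Proof.
by rewrite FE; exact: integrable_fubini_F.
Qed.

Let mpg : measurable_fun [set: Omega] (fun x => pint mu S f x * g x).
Proof.
by apply: measurable_funM => //; exact: measurable_pint.
Qed.

Lemma integrable_pull :
  (pm V).-integrable setT (EFin \o (fun x => pint mu S f x * g x)).
Proof.
apply/integrableP; split; first exact/measurable_EFinP.
have /integrableP[mF] := iF; apply: le_lt_trans.
rewrite le_eqVlt; apply/orP; left; apply/eqP.
apply: ae_eq_integral => //.
- by apply: measurableT_comp => //; exact/measurable_EFinP.
- exact: measurableT_comp.
- exact: ae_eq_abse ae_F.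
Qed.

(** Fubini's theorem with the factor [g], constant in the variables of [S], taken out of the inner
    integral. *)
Lemma Rintegral_pull :
  \int[pm U]_x (f x * g x) = \int[pm V]_x (pint mu S f x * g x).
Proof.
rewrite (Rintegral_transport _ mfg (m1 := (pm V \x pm S)%E)
  (phi := fun p => splice S p.2 p.1)); last by move=> h mh h0; exact: tonelli_pm.
congr fine.
rewrite -(integral12_prod_meas1 i2) -[X in (\int[_]_x X x)%E]FE.
apply: ae_eq_integral => //; last exact: ae_eq_sym.
- by case/integrableP : iF.
- exact/measurable_EFinP.
Qed.

End Pull.
End PartialMeasure.

(** * Products of functions of disjoint sets of variables *)

Section Tensor.
Context (R : realType) (d : nat) (mu : nat -> {finite_measure set R -> \bar R}).
Local Notation Omega := (d.-tuple R).
Variables (U S V : pred nat).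
Hypothesis USV : forall i, (i < d)%N -> U i = S i || V i.
Hypothesis SV : forall i, S i -> ~~ V i.
Variables p q : Omega -> R.
Hypothesis pS : forall w x, p (splice S w x) = p w.
Hypothesis qS : forall w x, q (splice S w x) = q x.
Hypothesis ip : (pm d mu S).-integrable setT (EFin \o p).
Hypothesis iq : (pm d mu V).-integrable setT (EFin \o q).

Let mp : measurable_fun [set: Omega] p.
Proof. by case/integrableP : ip => /measurable_EFinP. Qed.

Let mq : measurable_fun [set: Omega] q.
Proof. by case/integrableP : iq => /measurable_EFinP. Qed.

Lemma integrable_tensor :
  (pm d mu U).-integrable setT (EFin \o (fun x => p x * q x)).
Proof.
have mpq : measurable_fun [set: Omega] (fun x => p x * q x).
  exact: measurable_funM.
apply/integrableP; split; first exact/measurable_EFinP.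
rewrite (tonelli_pm mu USV SV)//; last first.
  by apply: measurableT_comp => //; exact/measurable_EFinP.
rewrite fubini_tonelli1//=; last first.
  apply/measurable_EFinP; apply: measurableT_comp => //.
  exact: (measurableT_comp mpq (measurable_splice2 S)).
rewrite /fubini_F/=.
under eq_integral => x _.
  under eq_integral => w _ do rewrite pS qS normrM EFinM muleC.
  rewrite ge0_integralZl//; last first.
    by apply/measurable_EFinP; exact: measurableT_comp.
  over.
rewrite /= ge0_integralZr//; last 2 first.
- by apply/measurable_EFinP; exact: measurableT_comp.
- exact: integral_ge0.
have /integrableP[_ fp] := ip; have /integrableP[_ fq] := iq.
by apply: lte_mul_pinfty => //; [exact: integral_ge0|rewrite ge0_fin_numE//;exact: integral_ge0].
Qed.

Lemma Rintegral_tensor : \int[pm d mu U]_x (p x * q x) =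
  (\int[pm d mu S]_x p x) * (\int[pm d mu V]_x q x).
Proof.
rewrite (Rintegral_pull USV SV mp mq qS integrable_tensor).
rewrite -(RintegralZl _ measurableT iq); apply: eq_Rintegral => x _; congr (_ * _).
by rewrite pint_splice//; apply: eq_Rintegral => w _; rewrite pS.
Qed.

End Tensor.

(** * Integrals of functions of one coordinate *)

Section SingleVariable.
Context (R : realType).
Implicit Types nu : nat -> {finite_measure set R -> \bar R}.

Lemma prod_measure_setT n nu : (forall i, (i < n)%N -> nu i setT = 1%E) ->
  prod_measure n nu setT = 1%E.
Proof.
move=> nu1; rewrite (_ : [set: n.-tuple R] = [set x : n.-tuple R | forall i, (i < n)%N -> setT x`_i]).
  rewrite (@prod_measure_box _ _ nu (fun=> setT))// big1// => i _.
  exact: nu1.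
by apply/seteqP; split.
Qed.

Lemma tonelli_nth n nu k (w : R -> \bar R) : (k < n)%N ->
  (forall i, (i < n)%N -> i != k -> nu i setT = 1%E) ->
  measurable_fun setT w -> (forall y, 0 <= w y)%E ->
  (\int[prod_measure n nu]_z w z`_k = \int[nu k]_y w y)%E.
Proof.
elim: n nu k => [//|n IHn] nu k kn nu1 mw w0.
rewrite tonelli_cons//; last first.
  by apply: measurableT_comp mw _; exact: measurable_nth.
case: k kn nu1 => [|k] kn nu1.
  apply: eq_integral => y _ /=.
  rewrite integral_cst// [X in (_ * X)%E]prod_measure_setT ?mule1//.
  by move=> i i_n; exact: nu1.
have IH := IHn (fun i => nu i.+1) k kn (fun i i_n ik => nu1 i.+1 i_n ik) mw w0.
under eq_integral do rewrite IH.
by rewrite integral_cst// [X in (_ * X)%E]nu1// mule1.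
Qed.

End SingleVariable.

(** * The space L2 *)

Section L2space.
Context d (T : measurableType d) (R : realType).
Variable nu : {measure set T -> \bar R}.
Implicit Types f g h : T -> R.

Lemma Lfun_measurable p f : f \in Lfun nu p -> measurable_fun [set: T] f.
Proof. by rewrite inE => /andP[]; rewrite inE. Qed.

Lemma L2_intM f g : f \in Lfun nu 2 -> g \in Lfun nu 2 ->
  nu.-integrable setT (EFin \o (fun x => f x * g x)).
Proof. by move=> Lf Lg; apply/Lfun1_integrable; exact: Lfun2_mul_Lfun1. Qed.

Lemma Lfun2P f : measurable_fun [set: T] f ->
  nu.-integrable setT (EFin \o (fun x => f x * f x)) -> f \in Lfun nu 2.
Proof.
move=> mf /integrableP[_ i]; rewrite inE; apply/andP; split; rewrite inE//=.
rewrite /finite_norm unlock poweR_lty//; apply: le_lt_trans i.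
rewrite le_eqVlt; apply/orP; left; apply/eqP; apply: eq_integral => x _ /=.
by rewrite powR_mulrn// normrM expr2.
Qed.

Lemma L2D f g : f \in Lfun nu 2 -> g \in Lfun nu 2 ->
  (fun x => f x + g x) \in Lfun nu 2.
Proof.
have p1 : (1 <= 2%:E :> \bar R)%E by rewrite lee_fin ler1n.
by move=> Lf Lg; have := (Lfun_addr_closed nu p1).2 f g Lf Lg.
Qed.

Lemma L2Z a f : f \in Lfun nu 2 -> (fun x => a * f x) \in Lfun nu 2.
Proof.
move=> Lf; rewrite (_ : (fun _ => _) = a \o* f); last first.
  by apply/funext => x /=; rewrite mulrC.
by apply: Lfun_scale => //; rewrite ler1n.
Qed.

Lemma L2N f : f \in Lfun nu 2 -> (fun x => - f x) \in Lfun nu 2.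
Proof.
move=> Lf; rewrite (_ : (fun _ => _) = fun x => -1 * f x); first exact: L2Z.
by apply/funext => x; rewrite mulN1r.
Qed.

Lemma L2B f g : f \in Lfun nu 2 -> g \in Lfun nu 2 ->
  (fun x => f x - g x) \in Lfun nu 2.
Proof. by move=> Lf Lg; apply: L2D => //; exact: L2N. Qed.

Lemma L20 : (fun _ : T => 0 : R) \in Lfun nu 2.
Proof.
have p1 : (1 <= 2%:E :> \bar R)%E by rewrite lee_fin ler1n.
by have := (Lfun_addr_closed nu p1).1.
Qed.

Lemma L2sum I (s : seq I) (P : pred I) (F : I -> T -> R) :
  (forall i, P i -> F i \in Lfun nu 2) ->
  (fun x => \sum_(i <- s | P i) F i x) \in Lfun nu 2.
Proof.
move=> LF; elim: s => [|i s IHs].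
  rewrite (_ : (fun _ => _) = fun=> 0); first exact: L20.
  by apply/funext => x; rewrite big_nil.
case: (boolP (P i)) => Pi; last first.
  rewrite (_ : (fun _ => _) = fun x => \sum_(i <- s | P i) F i x)//.
  by apply/funext => x; rewrite big_cons (negbTE Pi).
rewrite (_ : (fun _ => _) = fun x => F i x + \sum_(i <- s | P i) F i x).
  by apply: L2D => //; exact: LF.
by apply/funext => x; rewrite big_cons Pi.
Qed.

Lemma L2ipC f g : L2ip nu f g = L2ip nu g f.
Proof. by apply: eq_Rintegral => x _; rewrite mulrC. Qed.

Lemma L2ipDl f g h : f \in Lfun nu 2 -> g \in Lfun nu 2 -> h \in Lfun nu 2 ->
  L2ip nu (fun x => f x + g x) h = L2ip nu f h + L2ip nu g h.
Proof.
move=> Lf Lg Lh; rewrite /L2ip -RintegralD//; last 2 first.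
- exact: L2_intM.
- exact: L2_intM.
by apply: eq_Rintegral => x _; rewrite mulrDl.
Qed.

Lemma L2ipZl a f h : f \in Lfun nu 2 -> h \in Lfun nu 2 ->
  L2ip nu (fun x => a * f x) h = a * L2ip nu f h.
Proof.
move=> Lf Lh; rewrite /L2ip -(RintegralZl _ measurableT (L2_intM Lf Lh)).
by apply: eq_Rintegral => x _; rewrite mulrA.
Qed.

Lemma L2ipBl f g h : f \in Lfun nu 2 -> g \in Lfun nu 2 -> h \in Lfun nu 2 ->
  L2ip nu (fun x => f x - g x) h = L2ip nu f h - L2ip nu g h.
Proof.
move=> Lf Lg Lh; rewrite -[- L2ip nu g h]mulN1r -L2ipZl// -L2ipDl//; last exact: L2Z.
by congr L2ip; apply/funext => x; rewrite mulN1r.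
Qed.

Lemma L2ip0l h : L2ip nu (fun=> 0) h = 0.
Proof.
rewrite /L2ip; under eq_Rintegral do rewrite mul0r.
by rewrite /Rintegral integral0.
Qed.

Lemma L2ip_suml I (s : seq I) (P : pred I) (F : I -> T -> R) h :
  (forall i, P i -> F i \in Lfun nu 2) -> h \in Lfun nu 2 ->
  L2ip nu (fun x => \sum_(i <- s | P i) F i x) h =
  \sum_(i <- s | P i) L2ip nu (F i) h.
Proof.
move=> LF Lh; elim: s => [|i s IHs].
  rewrite big_nil (_ : (fun _ => _) = fun=> 0); first exact: L2ip0l.
  by apply/funext => x; rewrite big_nil.
rewrite big_cons; case: (boolP (P i)) => Pi; last first.
  rewrite -IHs; congr L2ip.
  by apply/funext => x; rewrite big_cons (negbTE Pi).
rewrite (_ : (fun _ => _) = fun x => F i x + \sum_(i <- s | P i) F i x).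
  by rewrite L2ipDl ?IHs//; [exact: LF|exact: L2sum].
by apply/funext => x; rewrite big_cons Pi.
Qed.

Lemma L2ip_ge0 f : 0 <= L2ip nu f f.
Proof. by apply: Rintegral_ge0 => x _; rewrite -expr2 sqr_ge0. Qed.

Lemma L2ip_fin f : f \in Lfun nu 2 ->
  (\int[nu]_x (f x * f x)%:E = (L2ip nu f f)%:E)%E.
Proof. by move=> Lf; rewrite fineK//; exact: integrable_fin_num (L2_intM Lf Lf). Qed.

Lemma LnormE f : f \in Lfun nu 2 ->
  ('N[nu]_2[EFin \o f] = (Num.sqrt (L2ip nu f f))%:E)%E.
Proof.
move=> Lf; rewrite unlock.
rewrite (eq_integral (fun x => (f x * f x)%:E)); last first.
  by move=> x _ /=; rewrite powR_mulrn// -normrX ger0_norm ?sqr_ge0// expr2.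
by rewrite L2ip_fin// poweR_EFin powR12_sqrt// L2ip_ge0.
Qed.

Lemma L2norm_sqr f : f \in Lfun nu 2 -> L2norm nu f ^+ 2 = L2ip nu f f.
Proof. by move=> Lf; rewrite /L2norm LnormE//= sqr_sqrtr// L2ip_ge0. Qed.

Lemma ae_L2ip f f' g : f = f' %[ae nu] -> measurable_fun setT f ->
  measurable_fun setT f' -> measurable_fun setT g ->
  L2ip nu f g = L2ip nu f' g.
Proof.
move=> ff' mf mf' mg; congr fine; apply: ae_eq_integral => //.
- by apply/measurable_EFinP; exact: measurable_funM.
- by apply/measurable_EFinP; exact: measurable_funM.
- by apply: filterS ff' => x /= /(_ I) ->.
Qed.

Lemma L2ip_eq0 f : f \in Lfun nu 2 -> L2ip nu f f = 0 -> f = cst 0 %[ae nu].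
Proof.
move=> Lf f0.
have : (\int[nu]_x `|(f x * f x)%:E| = 0)%E.
  under eq_integral do rewrite gee0_abs ?lee_fin -?expr2 ?sqr_ge0// expr2.
  by rewrite L2ip_fin// f0.
have mff := Lfun_measurable Lf.
move/(ae_eq_integral_abs nu measurableT).
have mff2 : measurable_fun setT (fun x => (f x * f x)%:E).
  by apply/measurable_EFinP; exact: measurable_funM.
move=> /(_ mff2); apply: filterS => x /= /(_ I) [] /eqP.
by rewrite mulf_eq0 orbb => /eqP.
Qed.

(** The polynomial [|f - a g|^2] in [a] is nonnegative; it is evaluated at a suitable [a]. *)
Lemma L2ip_CS f g : f \in Lfun nu 2 -> g \in Lfun nu 2 ->
  L2ip nu f g ^+ 2 <= L2ip nu f f * L2ip nu g g.
Proof.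
move=> Lf Lg; set A := L2ip nu f f; set B := L2ip nu f g; set C := L2ip nu g g.
have H a : 0 <= A - a * B - a * B + a * a * C.
  have := L2ip_ge0 (fun x => f x - a * g x).
  have La := L2Z a Lg.
  rewrite L2ipBl//; last exact: L2B.
  rewrite [X in X - _]L2ipC [X in _ - X]L2ipC L2ipBl// L2ipBl//.
  rewrite L2ipZl// L2ipZl// ![L2ip nu _ (fun x => a * g x)]L2ipC L2ipZl// L2ipZl//.
  by rewrite (L2ipC g f) -/A -/B -/C opprB addrA mulrA addrAC.
have A0 : 0 <= A := L2ip_ge0 f.
have C0 : 0 <= C := L2ip_ge0 g.
have [C_0|C_n0] := eqVneq C 0.
  rewrite C_0 mulr0; rewrite C_0 in H.
  have [->|B_n0] := eqVneq B 0; first by rewrite expr0n.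
  (* With [C = 0] the polynomial is [A - 2 a B]; at this [a] it equals [- A - 2 < 0]. *)
  have := H ((A + 1) / B); rewrite mulr0 addr0 divfK//; lra.
have Cp : 0 < C by rewrite lt_neqAle eq_sym C_n0.
(* The minimiser of the quadratic polynomial. *)
have := H (B / C).
rewrite (_ : _ + _ = (A * C - B ^+ 2) / C); last by field.
by rewrite pmulr_lge0 ?invr_gt0// subr_ge0.
Qed.

End L2space.

(** * Derivatives of curves in L2 *)

Section L2Derivative.
Context d (T : measurableType d) (R : realType).
Variable nu : {measure set T -> \bar R}.
Implicit Types (f g p : T -> R) (c : R -> T -> R).

Definition L2quot c p g (h : R) : T -> R := fun x => h^-1 * (c h x - p x) - g x.

(* [p] stands for [c 0], which the curve need only reach almost everywhere. *)
Definition L2curve_derive c p g : Prop :=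
  [/\ p \in Lfun nu 2, g \in Lfun nu 2,
      \forall h \near 0^', c h \in Lfun nu 2 &
      L2ip nu (L2quot c p g h) (L2quot c p g h) @[h --> 0^'] --> (0 : R)].

Lemma L2quot_L2 c p g h : c h \in Lfun nu 2 -> p \in Lfun nu 2 ->
  g \in Lfun nu 2 -> L2quot c p g h \in Lfun nu 2.
Proof. by move=> Lc Lp Lg; apply: L2B => //; apply: L2Z; exact: L2B. Qed.

(** The parallelogram identity with [|f - g|^2] dropped; it serves as the triangle inequality for
    squared norms. *)
Lemma L2sqD f g : f \in Lfun nu 2 -> g \in Lfun nu 2 ->
  L2ip nu (fun x => f x + g x) (fun x => f x + g x) <=
  2 * L2ip nu f f + 2 * L2ip nu g g.
Proof.
move=> Lf Lg; have := L2ip_ge0 nu (fun x => f x - g x).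
rewrite L2ipBl ?L2B// ![L2ip nu _ (fun x => f x - g x)]L2ipC !L2ipBl//.
rewrite L2ipDl ?L2D// ![L2ip nu _ (fun x => f x + g x)]L2ipC !L2ipDl//.
rewrite (L2ipC nu g f); lra.
Qed.

Lemma cvg0_le (F G : R -> R) : (\forall h \near 0^', 0 <= F h <= G h) ->
  G h @[h --> 0^'] --> (0 : R) -> F h @[h --> 0^'] --> (0 : R).
Proof.
move=> FG G0; apply: (squeeze_cvgr FG) => //; exact: cvg_cst.
Qed.

Lemma L2curve_deriveD c c' p p' g g' :
  L2curve_derive c p g -> L2curve_derive c' p' g' ->
  L2curve_derive (fun h x => c h x + c' h x) (fun x => p x + p' x)
    (fun x => g x + g' x).
Proof.
move=> [Lp Lg Lc cg] [Lp' Lg' Lc' cg']; split; [exact: L2D|exact: L2D| |].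
  by near=> h; apply: L2D; [near: h|near: h].
apply: (@cvg0_le _ (fun h => 2 * L2ip nu (L2quot c p g h) (L2quot c p g h) +
    2 * L2ip nu (L2quot c' p' g' h) (L2quot c' p' g' h))).
  near=> h; rewrite L2ip_ge0/=.
  rewrite (_ : L2quot _ _ _ h = fun x => L2quot c p g h x + L2quot c' p' g' h x).
    have ? : c h \in Lfun nu 2 by near: h.
    have ? : c' h \in Lfun nu 2 by near: h.
    by apply: L2sqD; exact: L2quot_L2.
  by apply/funext => x; rewrite /L2quot; ring.
rewrite -[X in _ --> X](_ : 2 * 0 + 2 * 0 = _); last by rewrite mulr0 addr0.
by apply: cvgD; apply: cvgMr.
Unshelve. all: by end_near. Qed.

Lemma L2curve_derive_cst p : p \in Lfun nu 2 ->
  L2curve_derive (fun=> p) p (fun=> 0).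
Proof.
move=> Lp; split => //; first exact: L20.
  by near=> h.
rewrite (_ : (fun _ => _) = fun=> 0); first exact: cvg_cst.
apply/funext => h; rewrite (_ : L2quot _ _ _ _ = fun=> 0) ?L2ip0l//.
by apply/funext => x; rewrite /L2quot subrr mulr0 subr0.
Unshelve. all: by end_near. Qed.

Lemma L2curve_derive_sum I (s : seq I) (P : pred I) (c : I -> R -> T -> R)
    (p g : I -> T -> R) : (forall i, P i -> L2curve_derive (c i) (p i) (g i)) ->
  L2curve_derive (fun h x => \sum_(i <- s | P i) c i h x)
    (fun x => \sum_(i <- s | P i) p i x) (fun x => \sum_(i <- s | P i) g i x).
Proof.
move=> H.
have sumE (F : I -> T -> R) :
    (fun x => \sum_(i <- s | P i) F i x) = \sum_(i <- s | P i) F i.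
  by apply/funext => x; rewrite fct_sumE.
rewrite (_ : (fun h x => _) = fun h => \sum_(i <- s | P i) c i h); last first.
  by apply/funext => h; exact: sumE.
rewrite !sumE; elim: s {sumE} => [|i s IHs].
  rewrite !big_nil (_ : (fun _ => _) = fun=> (fun=> 0)).
    by apply: L2curve_derive_cst; exact: L20.
  by apply/funext => h; rewrite big_nil.
rewrite !big_cons (_ : (fun _ => _) = fun h =>
  if P i then c i h + \sum_(j <- s | P j) c j h else \sum_(j <- s | P j) c j h);
  last by apply/funext => h; rewrite big_cons.
by case: ifPn => // Pi; apply: L2curve_deriveD => //; exact: H.
Qed.

(** For each [h], [g - g'] is the difference of the two errors [L2quot c p g' h] and
    [L2quot c p g h], both of which tend to 0. *)
Lemma L2curve_derive_uniq c p g g' : L2curve_derive c p g ->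
  L2curve_derive c p g' -> g = g' %[ae nu].
Proof.
move=> [Lp Lg Lc cg] [_ Lg' _ cg'].
have Lgg' : (fun x => g x - g' x) \in Lfun nu 2 by exact: L2B.
suff /(L2ip_eq0 Lgg') : L2ip nu (fun x => g x - g' x) (fun x => g x - g' x) = 0.
  by apply: filterS => x /= /(_ I) /eqP; rewrite subr_eq0 => /eqP.
apply/eqP; rewrite eq_le L2ip_ge0 andbT.
have cv : 2 * L2ip nu (L2quot c p g' h) (L2quot c p g' h) +
    2 * L2ip nu (L2quot c p g h) (L2quot c p g h) @[h --> 0^'] --> (0 : R).
  rewrite -[X in _ --> X](_ : 2 * 0 + 2 * 0 = _); last by rewrite mulr0 addr0.
  by apply: cvgD; apply: cvgMr.
apply: (ler_cvg_to (@cvg_cst _ _ _ _ _) cv).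
near=> h; have Lch : c h \in Lfun nu 2 by near: h.
have L1 := L2quot_L2 Lch Lp Lg'; have L2 := L2quot_L2 Lch Lp Lg.
have := L2sqD L1 (L2N L2); rewrite [X in L2ip nu X X <= _](_ : _ = fun x => g x - g' x).
  move=> /le_trans -> //; rewrite lerD2l ler_wpM2l//.
  rewrite (_ : (fun x => - _) = fun x => -1 * L2quot c p g h x); last first.
    by apply/funext => x; rewrite mulN1r.
  by rewrite L2ipZl ?L2Z// L2ipC L2ipZl// mulrA mulrNN !mul1r.
by apply/funext => x; rewrite /L2quot; ring.
Unshelve. all: by end_near. Qed.

(** Passes from norms in the extended reals to real squared norms, and from the value [c s] to its
    representative [p]. The norms agree for small [h], where [c (s + h)] is in L2; the limit 0 is
    preserved by squaring and by the square root. *)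
Lemma L2curve_deriveP c s p g : (\forall t \near s, c t \in Lfun nu 2) ->
  c s = p %[ae nu] -> p \in Lfun nu 2 ->
  is_L2derive nu c s g <-> L2curve_derive (fun h => c (s + h)) p g.
Proof.
move=> Lc csp Lp.
have Lcs : c s \in Lfun nu 2 by exact: nbhs_singleton Lc.
have Lch : \forall h \near 0^', c (s + h) \in Lfun nu 2.
  have : \forall h \near (0 : R), c (s + h) \in Lfun nu 2.
    have : s + h @[h --> (0 : R)] --> s.
      by rewrite -[X in _ --> X]addr0; apply: cvgD; [exact: cvg_cst|exact: cvg_id].
    by move=> /(_ _ Lc).
  by move=> H; near=> h; near: h; exact: nbhs_dnbhs.
have NE : g \in Lfun nu 2 -> \forall h \near 0^',
    ('N[nu]_2[EFin \o (fun x => h^-1 * (c (s + h) x - c s x) - g x)%R])%E =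
    (Num.sqrt (L2ip nu (L2quot (fun h => c (s + h)) p g h)
                    (L2quot (fun h => c (s + h)) p g h)))%:E.
  move=> Lg; near=> h; have L1 : c (s + h) \in Lfun nu 2 by near: h.
  have La := @L2quot_L2 (fun h => c (s + h)) _ _ _ L1 Lcs Lg.
  have Lb := @L2quot_L2 (fun h => c (s + h)) _ _ _ L1 Lp Lg.
  rewrite (LnormE La).
  have aeq : L2quot (fun h => c (s + h)) (c s) g h =
             L2quot (fun h => c (s + h)) p g h %[ae nu].
    by apply: filterS csp => x /= /(_ I) e _; rewrite /L2quot e.
  have mLa := Lfun_measurable La; have mLb := Lfun_measurable Lb.
  by rewrite (ae_L2ip aeq)// L2ipC (ae_L2ip aeq).
split=> [[Lg cv]|[_ Lg _ cv]].
- split => //.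
  have {}cv : Num.sqrt (L2ip nu (L2quot (fun h => c (s + h)) p g h)
                    (L2quot (fun h => c (s + h)) p g h)) @[h --> 0^'] --> 0.
    have : (Num.sqrt (L2ip nu (L2quot (fun h => c (s + h)) p g h)
                    (L2quot (fun h => c (s + h)) p g h)))%:E @[h --> 0^'] --> 0%E.
      by apply: cvg_trans cv; apply: near_eq_cvg; exact: NE.
    by move/fine_cvgP => [].
  have cv2 := cvgM cv cv; rewrite mulr0 in cv2.
  apply: cvg_trans (cv2 _); apply: near_eq_cvg; near=> h => /=.
  by rewrite -expr2 sqr_sqrtr// L2ip_ge0.
- split => //.
  have {}cv : Num.sqrt (L2ip nu (L2quot (fun h => c (s + h)) p g h)
                    (L2quot (fun h => c (s + h)) p g h)) @[h --> 0^'] --> (0 : R).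
    by have := cvg_comp _ _ cv (@sqrt_continuous R 0); rewrite sqrtr0.
  have : (Num.sqrt (L2ip nu (L2quot (fun h => c (s + h)) p g h)
                    (L2quot (fun h => c (s + h)) p g h)))%:E @[h --> 0^'] --> 0%E.
    by apply/fine_cvgP; split; [exact: nearW|exact: cv].
  apply: cvg_trans; apply: near_eq_cvg.
  by apply: filterS (NE Lg) => h ->.
Unshelve. all: by end_near. Qed.

End L2Derivative.

(** * L2 functions of one coordinate *)

Section Coordinate.
Context (R : realType) (d : nat) (mu : nat -> {finite_measure set R -> \bar R}).
Variable k : nat.
Hypothesis kd : (k < d)%N.

Lemma tonelli_coord (w : R -> \bar R) : measurable_fun setT w ->
  (forall y, 0 <= w y)%E ->
  (\int[mu k]_y w y = \int[pm d mu (fun i => i == k)]_z w z`_k)%E.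
Proof.
move=> mw w0; rewrite /pm tonelli_nth ?eqxx// => i _ /negbTE ->.
exact: diracT_eq1.
Qed.

Lemma integrable_coord (w : R -> R) : measurable_fun setT w ->
  (mu k).-integrable setT (EFin \o w) <->
  (pm d mu (fun i => i == k)).-integrable setT (EFin \o (fun z => w z`_k)).
Proof.
move=> mw; have := integrable_transport (measurable_nth kd) tonelli_coord mw.
exact.
Qed.

Lemma Rintegral_coord (w : R -> R) : measurable_fun setT w ->
  \int[mu k]_y w y = \int[pm d mu (fun i => i == k)]_z w z`_k.
Proof. exact: (Rintegral_transport tonelli_coord). Qed.

Lemma L2_coord (w : R -> R) : w \in Lfun (mu k) 2 ->
  (fun z : d.-tuple R => w z`_k) \in Lfun (pm d mu (fun i => i == k)) 2.
Proof.
move=> Lw; have mw := Lfun_measurable Lw; apply: Lfun2P.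
  exact: (measurableT_comp mw (measurable_nth kd)).
apply/(@integrable_coord (fun y => w y * w y)); first exact: measurable_funM.
exact: L2_intM.
Qed.

Lemma L2ip_coord (w w' : R -> R) : measurable_fun setT w ->
  measurable_fun setT w' ->
  L2ip (pm d mu (fun i => i == k)) (fun z => w z`_k) (fun z => w' z`_k) =
  L2ip (mu k) w w'.
Proof.
move=> mw mw'; rewrite /L2ip (@Rintegral_coord (fun y => w y * w' y))//.
exact: measurable_funM.
Qed.

End Coordinate.

(** * L2 norms of products of functions of disjoint variables *)

Section L2Tensor.
Context (R : realType) (d : nat) (mu : nat -> {finite_measure set R -> \bar R}).
Local Notation Omega := (d.-tuple R).
Variables (U S V : pred nat).
Hypothesis USV : forall i, (i < d)%N -> U i = S i || V i.
Hypothesis SV : forall i, S i -> ~~ V i.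

(** Pointwise and not up to null sets, since the functions are evaluated at spliced points. *)
Definition depends_on (W : pred nat) (p : Omega -> R) : Prop :=
  forall x y : Omega, (forall i, (i < d)%N -> W i -> x`_i = y`_i) -> p x = p y.

Lemma depends_onS (W W' : pred nat) p :
  (forall i, (i < d)%N -> W i -> W' i) -> depends_on W p -> depends_on W' p.
Proof. by move=> WW' h x y xy; apply: h => i i_d Wi; apply: xy => //; exact: WW'. Qed.

Lemma depends_splicel p w x : depends_on S p -> p (splice S w x) = p w.
Proof. by apply => i i_d Si; rewrite nth_splice// Si. Qed.

Lemma depends_splicer p w x : depends_on V p -> p (splice S w x) = p x.
Proof.
by apply => i i_d Vi; rewrite nth_splice//; case: ifPn => // /SV; rewrite Vi.
Qed.

Variables p p' q q' : Omega -> R.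
Hypotheses (pS : depends_on S p) (pS' : depends_on S p').
Hypotheses (qV : depends_on V q) (qV' : depends_on V q').
Hypotheses (Lp : p \in Lfun (pm d mu S) 2) (Lp' : p' \in Lfun (pm d mu S) 2).
Hypotheses (Lq : q \in Lfun (pm d mu V) 2) (Lq' : q' \in Lfun (pm d mu V) 2).

Lemma L2_tensor : (fun x => p x * q x) \in Lfun (pm d mu U) 2.
Proof.
apply: Lfun2P.
  by apply: measurable_funM; [exact: Lfun_measurable Lp|exact: Lfun_measurable Lq].
rewrite (_ : _ \o _ = EFin \o (fun x => (p x * p x) * (q x * q x))); last first.
  by apply/funext => x /=; rewrite mulrACA.
apply: (integrable_tensor USV SV _ _ (L2_intM Lp Lp) (L2_intM Lq Lq)) => w x.
  by rewrite depends_splicel.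
by rewrite depends_splicer.
Qed.

Lemma L2ip_tensor : L2ip (pm d mu U) (fun x => p x * q x) (fun x => p' x * q' x) =
  L2ip (pm d mu S) p p' * L2ip (pm d mu V) q q'.
Proof.
rewrite /L2ip.
under eq_Rintegral do rewrite mulrACA.
apply: (Rintegral_tensor USV SV _ _ (L2_intM Lp Lp') (L2_intM Lq Lq')) => w x.
  by rewrite !depends_splicel.
by rewrite !depends_splicer.
Qed.

End L2Tensor.

(** * Product rule for functions of disjoint variables *)

Section L2TensorDerivative.
Context (R : realType) (d : nat) (mu : nat -> {finite_measure set R -> \bar R}).
Local Notation Omega := (d.-tuple R).
Variables (U S V : pred nat).
Hypothesis USV : forall i, (i < d)%N -> U i = S i || V i.
Hypothesis SV : forall i, S i -> ~~ V i.

(** Differentiable curves are continuous: [c h - p] is [h] times the sum of the error and [g]. *)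
Lemma L2curve_derive_cvg d' (T : measurableType d') (nu : {measure set T -> \bar R})
    (c : R -> T -> R) (p g : T -> R) : L2curve_derive nu c p g ->
  L2ip nu (fun x => c h x - p x) (fun x => c h x - p x) @[h --> 0^'] --> (0 : R).
Proof.
move=> [Lp Lg Lc cg].
apply: (@cvg0_le _ _ (fun h => h * h * (2 * L2ip nu (L2quot c p g h) (L2quot c p g h) +
   2 * L2ip nu g g))).
  near=> h; have h0 : h != 0 by near: h; exact: nbhs_dnbhs_neq.
  have Lch : c h \in Lfun nu 2 by near: h.
  have Lq := L2quot_L2 Lch Lp Lg.
  rewrite L2ip_ge0/=.
  rewrite (_ : (fun x => c h x - p x) = fun x => h * (L2quot c p g h x + g x)).
    have Lqg := L2D Lq Lg; have Lhqg := L2Z h Lqg.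
    rewrite (L2ipZl h Lqg Lhqg) L2ipC (L2ipZl h Lqg Lqg) mulrA.
    by apply: ler_wpM2l; [rewrite -expr2 sqr_ge0|exact: L2sqD].
  by apply/funext => x; rewrite /L2quot subrK mulrA divff// mul1r.
rewrite -[X in _ --> X](_ : 0 * 0 * (2 * 0 + 2 * L2ip nu g g) = _); last by rewrite !mul0r.
apply: cvgM; first by apply: cvgM; exact: cvg_within.
apply: cvgD; last exact: cvg_cst.
exact: cvgMr.
Unshelve. all: by end_near. Qed.

(** The usual decomposition of the error into three products. Each joins functions of disjoint
    variables, so its squared norm is a product of squared norms, one factor of which tends to 0. *)
Lemma L2curve_derive_tensor (c c' : R -> Omega -> R) p p' g g' :
  (forall h, depends_on S (c h)) -> depends_on S p -> depends_on S g ->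
  (forall h, depends_on V (c' h)) -> depends_on V p' -> depends_on V g' ->
  L2curve_derive (pm d mu S) c p g -> L2curve_derive (pm d mu V) c' p' g' ->
  L2curve_derive (pm d mu U) (fun h x => c h x * c' h x) (fun x => p x * p' x)
    (fun x => g x * p' x + p x * g' x).
Proof.
move=> cS pS gS cV pV gV.
move=> /[dup] [[Lp Lg Lc cg]] D /[dup] [[Lp' Lg' Lc' cg']] D'.
have Lgp : (fun x => g x * p' x) \in Lfun (pm d mu U) 2 by exact: (L2_tensor USV SV).
have Lpg : (fun x => p x * g' x) \in Lfun (pm d mu U) 2 by exact: (L2_tensor USV SV).
split; [exact: (L2_tensor USV SV)|exact: L2D| |].
  by near=> h; apply: (L2_tensor USV SV) => //; near: h.
pose q h := L2quot c p g h; pose q' h := L2quot c' p' g' h.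
have qS h : depends_on S (q h).
  by move=> x y xy; rewrite /q /L2quot (cS _ _ _ xy) (pS _ _ xy) (gS _ _ xy).
have qV h : depends_on V (q' h).
  by move=> x y xy; rewrite /q' /L2quot (cV _ _ _ xy) (pV _ _ xy) (gV _ _ xy).
have eV h : depends_on V (fun x => c' h x - p' x).
  by move=> x y xy; rewrite (cV _ _ _ xy) (pV _ _ xy).
(* Two uses of [L2sqD] on the three products below, and one more to bound [|c' h|^2] by
   [|c' h - p'|^2] and [|p'|^2]. *)
pose B h := 2 * (L2ip (pm d mu S) (q h) (q h) *
    (2 * L2ip (pm d mu V) (fun x => c' h x - p' x) (fun x => c' h x - p' x)
      + 2 * L2ip (pm d mu V) p' p')) +
  2 * (2 * (L2ip (pm d mu S) g g *
    L2ip (pm d mu V) (fun x => c' h x - p' x) (fun x => c' h x - p' x)) +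
   2 * (L2ip (pm d mu S) p p * L2ip (pm d mu V) (q' h) (q' h))).
apply: (@cvg0_le _ _ B).
  near=> h; rewrite L2ip_ge0/=.
  have Lch : c h \in Lfun (pm d mu S) 2 by near: h.
  have Lch' : c' h \in Lfun (pm d mu V) 2 by near: h.
  have Lq : q h \in Lfun (pm d mu S) 2 by exact: L2quot_L2.
  have Lq' : q' h \in Lfun (pm d mu V) 2 by exact: L2quot_L2.
  have Le : (fun x => c' h x - p' x) \in Lfun (pm d mu V) 2 by exact: L2B.
  rewrite (_ : L2quot _ _ _ h = fun x => q h x * c' h x +
    (g x * (c' h x - p' x) + p x * q' h x)); last first.
    by apply/funext => x; rewrite /q /q' /L2quot; ring.
  have L1 : (fun x => q h x * c' h x) \in Lfun (pm d mu U) 2 by exact: (L2_tensor USV SV).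
  have L2 : (fun x => g x * (c' h x - p' x)) \in Lfun (pm d mu U) 2 by exact: (L2_tensor USV SV).
  have L3 : (fun x => p x * q' h x) \in Lfun (pm d mu U) 2 by exact: (L2_tensor USV SV).
  apply: le_trans (L2sqD L1 (L2D L2 L3)) _; rewrite /B lerD// ler_wpM2l//.
    rewrite (L2ip_tensor USV SV)// ler_wpM2l ?L2ip_ge0//.
    rewrite [X in L2ip _ X X <= _](_ : _ = fun x => (c' h x - p' x) + p' x); last first.
      by apply/funext => x; rewrite subrK.
    exact: L2sqD.
  by apply: le_trans (L2sqD L2 L3) _; rewrite !(L2ip_tensor USV SV).
have e0 := L2curve_derive_cvg D'.
rewrite -[X in _ --> X](_ : 2 * (0 * (2 * 0 + 2 * L2ip (pm d mu V) p' p')) +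
  2 * (2 * (L2ip (pm d mu S) g g * 0) + 2 * (L2ip (pm d mu S) p p * 0)) = _);
  last by rewrite !(mul0r, mulr0, addr0).
apply: cvgD; apply: cvgMr.
  by apply: cvgM => //; apply: cvgD; [exact: cvgMr|exact: cvg_cst].
by apply: cvgD; apply: cvgMr; exact: cvgMr.
Unshelve. all: by end_near. Qed.

End L2TensorDerivative.

(** * Square integrability from a bound on the dual pairing *)

Section Duality.
Context d (T : measurableType d) (R : realType).
Variable nu : {finite_measure set T -> \bar R}.
Variables (f : T -> R) (K : R).
Hypothesis mf : measurable_fun [set: T] f.
Hypothesis K_ge0 : 0 <= K.
Hypothesis bf : forall w, w \in Lfun nu 2 -> L2ip nu w f ^+ 2 <= K * L2ip nu w w.

(* Test against the truncations of [f] itself. *)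
Lemma L2_of_dual_bound : f \in Lfun nu 2.
Proof.
pose t n x := if `|f x| <= n%:R then f x else 0.
have mt n : measurable_fun [set: T] (t n).
  apply: measurable_fun_ifT => //; apply: measurable_fun_ler => //.
  exact: measurableT_comp.
have tb n x : `|t n x| <= n%:R by rewrite /t; case: ifPn => // _; rewrite normr0.
have Lt n : t n \in Lfun nu 2.
  apply: Lfun2P => //; apply: measurable_bounded_integrable => //.
  - by rewrite -ge0_fin_numE// fin_num_measure.
  - exact: measurable_funM.
  exists (n%:R * n%:R); split; first exact: num_real.
  move=> y /ltW ny x _ /=; apply: le_trans ny.
  by rewrite normrM ler_pM.
have tf n x : t n x * f x = t n x * t n x.
  by rewrite /t; case: ifPn => // _; rewrite !mul0r.
(* As [t n * f] is the square of [t n], the hypothesis reads [I ^+ 2 <= K * I] for [I] the squared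
   norm of [t n]; divide by [I] unless it is 0. *)
have tK n : L2ip nu (t n) (t n) <= K.
  have := bf (Lt n).
  rewrite (_ : L2ip nu (t n) f = L2ip nu (t n) (t n)); last first.
    by apply: eq_Rintegral => x _; rewrite tf.
  have := L2ip_ge0 nu (t n); rewrite le_eqVlt => /predU1P[<- _|I0].
    exact: K_ge0.
  by rewrite expr2 ler_pM2r.
apply: Lfun2P => //; apply/integrableP; split.
  by apply/measurable_EFinP; exact: measurable_funM.
under eq_integral do rewrite /= ger0_norm -?expr2 ?sqr_ge0// expr2.
apply: (@le_lt_trans _ _ K%:E); last exact: ltry.
(* At each point the truncations are eventually equal to [f], and their squares increase, so
   monotone convergence carries the bound [K] over to [f]. *)
have tlim x : limn (fun n => (t n x * t n x)%:E) = (f x * f x)%:E.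
  apply: lim_near_cst => //; near=> n.
  rewrite /t (_ : `|f x| <= n%:R)//; near: n; exact: nbhs_infty_ger.
under eq_integral do rewrite -tlim.
rewrite monotone_convergence//.
- apply: lime_le.
    apply: ereal_nondecreasing_is_cvgn => m n mn; apply: ge0_le_integral => //.
    + by move=> x _; rewrite lee_fin -expr2 sqr_ge0.
    + by apply/measurable_EFinP; exact: measurable_funM.
    + by apply/measurable_EFinP; exact: measurable_funM.
    + move=> x _; rewrite lee_fin /t; case: ifPn => [fm|_].
        by rewrite (le_trans fm) ?ler_nat.
      by case: ifPn; rewrite mul0r -?expr2 ?sqr_ge0.
  by apply: nearW => n; rewrite L2ip_fin// lee_fin.
- by move=> n; apply/measurable_EFinP; exact: measurable_funM.
- by move=> n x _; rewrite lee_fin -expr2 sqr_ge0.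
- move=> x _ m n mn; rewrite lee_fin /t; case: ifPn => [fm|_].
    by rewrite (le_trans fm) ?ler_nat.
  by case: ifPn; rewrite mul0r -?expr2 ?sqr_ge0.
Unshelve. all: by end_near. Qed.

End Duality.

(** * Products of cores *)

Section SplitIndices.
Variable d : nat.

Lemma split_ltS k i : (i < d)%N -> (i < k.+1)%N = (i < k)%N || (i == k).
Proof. by move=> _; rewrite ltnS leq_eqVlt orbC. Qed.

Lemma disj_ltS k i : (i < k)%N -> i != k.
Proof. by move/ltn_eqF ->. Qed.

Lemma split_leS k i : (i < d)%N -> (k <= i)%N = (i == k) || (k < i)%N.
Proof. by move=> _; rewrite leq_eqVlt eq_sym. Qed.

Lemma disj_leS k i : i == k -> ~~ (k < i)%N.
Proof. by move/eqP ->; rewrite ltnn. Qed.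

Lemma split_T k i : (i < d)%N -> xpredT i = (i < k)%N || (k <= i)%N.
Proof. by move=> _; rewrite [(k <= i)%N]leqNgt orbN. Qed.

Lemma disj_T k i : (i < k)%N -> ~~ (k <= i)%N.
Proof. by rewrite -ltnNge. Qed.

End SplitIndices.

Section Cores.
Context (R : realType) (d : nat) (r : nat -> nat).
Variable mu : nat -> {finite_measure set R -> \bar R}.
Local Notation Omega := (d.-tuple R).
Implicit Types (Psi A B V W : cores R r) (k : nat).

(* The entries of the row vector [1 Psi_1 ... Psi_k] and of the column vector
   [Psi_(k+1) ... Psi_d 1], where [1] has a single entry as r_0 = r_d = 1. *)
Definition lrow Psi k (a : 'I_(r k)) (x : Omega) : R :=
  \sum_(i < r 0%N) lprod Psi k x i a.

Definition rcol Psi k (b : 'I_(r k)) (x : Omega) : R :=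
  \sum_(j < r d) Phi Psi k x b j.

Definition upd A V k : cores R r := fun i => if i == k then V i else A i.

Lemma lrow0 Psi a (x : Omega) : lrow Psi (k := 0%N) a x = 1.
Proof.
by rewrite /lrow /= (bigD1 a)//= mxE eqxx big1 ?addr0// => i /negbTE ia; rewrite mxE ia.
Qed.

Lemma lrowS Psi k a x :
  lrow Psi (k := k.+1) a x = \sum_(m < r k) lrow Psi m x * Psi k x`_k m a.
Proof.
rewrite /lrow /=; under eq_bigr do rewrite mxE; rewrite exchange_big/=.
by apply: eq_bigr => m _; rewrite mulr_suml.
Qed.

Lemma rcolS Psi k b (x : Omega) : (k < d)%N ->
  rcol Psi b x = \sum_(m < r k.+1) Psi k x`_k b m * rcol Psi m x.
Proof.
move=> kd; rewrite /rcol /Phi -(subnSK kd) /=.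
under eq_bigr do rewrite mxE; rewrite exchange_big/=.
by apply: eq_bigr => m _; rewrite mulr_sumr.
Qed.

Lemma rcol_last Psi k b (x : Omega) : k = d -> r d = 1%N ->
  rcol Psi (k := k) b x = 1.
Proof.
move=> kd rd; subst k; rewrite /rcol /Phi subnn /= (bigD1 b)//= mxE eqxx ltn_ord big1 ?addr0//.
by move=> j /negbTE jb; rewrite mxE eq_sym -[_ == _ :> nat]/(j == b) jb.
Qed.

Lemma lprod_rprod Psi n k (x : Omega) i j : (n + k)%N = d ->
  (lprod Psi k x *m rprod Psi n k x) i j = lprod Psi d x i j.
Proof.
elim: n k => [|n IHn] k nkd /=.
  by rewrite add0n in nkd; subst k; rewrite pid_mx_1 mulmx1.
by rewrite mulmxA -[_ *m Psi k _]/(lprod Psi k.+1 x) IHn// addnS.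
Qed.

(** Isolates core [k]: the tensor is linear in it, and the three factors of each term depend on
    disjoint sets of variables. *)
Lemma fttE Psi k (x : Omega) : (k < d)%N -> ftt Psi x =
  \sum_(a < r k) \sum_(b < r k.+1) lrow Psi a x * (Psi k x`_k a b * rcol Psi b x).
Proof.
move=> kd.
transitivity (\sum_(a < r k) lrow Psi a x * rcol Psi a x); last first.
  by apply: eq_bigr => a _; rewrite rcolS// mulr_sumr.
rewrite /ftt.
under eq_bigr => i _ do under eq_bigr => j _ do
  rewrite -(lprod_rprod Psi x i j (subnK (ltnW kd))) mxE.
rewrite /lrow /rcol.
under eq_bigr => i _ do rewrite exchange_big/=.
rewrite exchange_big/=; apply: eq_bigr => a _.
rewrite mulr_suml; apply: eq_bigr => i _.
by rewrite mulr_sumr.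
Qed.

Lemma eq_lrow A B k a (x : Omega) : (forall i, (i < k)%N -> A i = B i) ->
  lrow A (k := k) a x = lrow B a x.
Proof.
elim: k a => [|k IHk] a AB; first by rewrite !lrow0.
rewrite !lrowS AB//; apply: eq_bigr => m _; rewrite IHk// => i ik.
by apply: AB; exact: ltnW.
Qed.

Lemma eq_rcol A B k b (x : Omega) : (forall i, (k <= i)%N -> A i = B i) ->
  rcol A (k := k) b x = rcol B b x.
Proof.
move=> AB; apply: eq_bigr => j _; rewrite /Phi.
move: (d - k)%N => n; elim: n k b AB => [//|m IHm] k b AB /=.
rewrite !mxE AB//; apply: eq_bigr => l _; rewrite IHm// => i ki.
by apply: AB; exact: ltnW.
Qed.

Lemma lrow_depends Psi k a : (k <= d)%N ->
  depends_on (fun i => (i < k)%N) (lrow Psi (k := k) a : Omega -> R).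
Proof.
elim: k a => [|k IHk] a kd x y xy; first by rewrite !lrow0.
rewrite !lrowS xy//; apply: eq_bigr => m _; congr (_ * _).
by apply: IHk => [|i i_d ik]; [exact: ltnW|apply: xy => //; exact: ltnW].
Qed.

Lemma rcol_depends Psi k b : (k <= d)%N ->
  depends_on (fun i => (k <= i)%N) (rcol Psi (k := k) b : Omega -> R).
Proof.
move=> kd x y xy; apply: eq_bigr => j _; rewrite /Phi.
have : (k + (d - k) = d)%N by rewrite subnKC.
move: (d - k)%N => n; elim: n k kd b xy => [//|m IHm] k kd b xy kmd /=.
have k_d : (k < d)%N by rewrite -kmd addnS ltnS leq_addr.
rewrite !mxE xy//; apply: eq_bigr => l _; rewrite IHm// ?addSnnS// => i i_d ki.
by apply: xy => //; exact: ltnW.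
Qed.

Lemma coord_depends k (w : R -> R) : (k < d)%N ->
  depends_on (fun i => i == k) ((fun x => w x`_k) : Omega -> R).
Proof. by move=> kd x y xy; rewrite xy. Qed.

Definition L2cores A := forall i, (i < d)%N -> forall j l,
  (fun y => A i y j l) \in Lfun (mu i) 2.

Lemma L2cores_upd A V k : L2cores A -> L2cores V -> L2cores (upd A V k).
Proof. by move=> LA LV i i_d j l; rewrite /upd; case: ifP => _; [exact: LV|exact: LA]. Qed.

(** Each core brings a new variable, so the products stay in L2, which need not hold for products of
    L2 functions of the same variable. *)
Lemma lrow_L2 Psi k a : L2cores Psi -> (k <= d)%N ->
  lrow Psi (k := k) a \in Lfun (pm d mu (fun i => (i < k)%N)) 2.
Proof.
move=> LPsi; elim: k a => [|k IHk] a kd.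
  rewrite (_ : lrow _ _ = cst 1); first exact: Lfun_cst.
  by apply/funext => x; rewrite lrow0.
rewrite (_ : lrow _ _ = fun x => \sum_(m < r k) lrow Psi m x * Psi k x`_k m a); last first.
  by apply/funext => x; rewrite lrowS.
apply: L2sum => m _.
apply: (L2_tensor (@split_ltS d k) (@disj_ltS k)).
- exact/lrow_depends/ltnW.
- exact: (@coord_depends k (fun y => Psi k y m a)).
- exact/IHk/ltnW.
- exact: (L2_coord _ (LPsi _ _ _ _)).
Qed.

Lemma rcol_L2 Psi k b : L2cores Psi -> (k <= d)%N ->
  rcol Psi (k := k) b \in Lfun (pm d mu (fun i => (k <= i)%N)) 2.
Proof.
move=> LPsi; move: {2}(d - k)%N (erefl (d - k)%N) => m.
elim: m k b => [|m IHm] k b dk kd.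
  have {dk} ? : k = d by apply/eqP; rewrite eqn_leq kd -subn_eq0 dk.
  subst k; rewrite (_ : rcol _ _ = cst (\sum_(j < r d) pid_mx (r d) b j)); first exact: Lfun_cst.
  by apply/funext => x; rewrite /rcol /Phi subnn.
have k_d : (k < d)%N by rewrite -subn_gt0 dk.
rewrite (_ : rcol _ _ = fun x => \sum_(m < r k.+1) Psi k x`_k b m * rcol Psi m x); last first.
  by apply/funext => x; rewrite rcolS.
apply: L2sum => l _.
apply: (L2_tensor (@split_leS d k) (@disj_leS k)).
- exact: (@coord_depends k (fun y => Psi k y b l)).
- exact: rcol_depends.
- exact: (L2_coord _ (LPsi _ _ _ _)).
- by apply: IHm => //; rewrite subnS dk.
Qed.

Lemma elem_L2 A B k a b (w : R -> R) : L2cores A -> L2cores B -> (k < d)%N ->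
  w \in Lfun (mu k) 2 ->
  (fun x => lrow A (k := k) a x * (w x`_k * rcol B (k := k.+1) b x))
    \in Lfun (prod_measure d mu) 2.
Proof.
move=> LA LB kd Lw; rewrite -pmT.
apply: (L2_tensor (@split_T d k) (@disj_T k)).
- exact/lrow_depends/ltnW.
- move=> x y xy; rewrite xy//; congr (_ * _); apply: (rcol_depends B b) => //.
  by move=> i i_d ki; apply: xy => //; exact: ltnW.
- exact/lrow_L2/ltnW.
- apply: (L2_tensor (@split_leS d k) (@disj_leS k)).
  + exact: coord_depends.
  + exact: rcol_depends.
  + exact: L2_coord.
  + exact: rcol_L2.
Qed.

End Cores.

Section PartialIntegrals.
Context (R : realType) (d : nat) (mu : nat -> {finite_measure set R -> \bar R}).
Local Notation Omega := (d.-tuple R).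
Implicit Types (S W : pred nat) (f : Omega -> R).

Lemma pint_depends S W f : measurable_fun [set: Omega] f -> depends_on W f ->
  depends_on (fun i => W i && ~~ S i) (pint mu S f).
Proof.
move=> mf Wf x y xy; rewrite !pint_splice//; apply: eq_Rintegral => w _.
apply: Wf => i i_d Wi; rewrite !nth_splice//; case: ifPn => // Si.
by rewrite xy// Wi.
Qed.

Lemma pint_full S f x : measurable_fun [set: Omega] f -> depends_on S f ->
  pint mu S f x = \int[pm d mu S]_w f w.
Proof.
move=> mf Sf; rewrite pint_splice//; apply: eq_Rintegral => w _.
by rewrite (depends_splicel _ _ Sf).
Qed.

Lemma pint_none S f x : measurable_fun [set: Omega] f ->
  (forall i, (i < d)%N -> S i = false) -> pint mu S f x = f x.
Proof.
move=> mf S0; rewrite pint_splice//.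
have sE w : splice S w x = x by apply: eq_nthT => i i_d; rewrite nth_splice// S0.
under eq_Rintegral do rewrite sE.
rewrite Rintegral_cst// [X in fine X]prod_measure_setT ?mulr1// => i i_d.
by rewrite S0//; exact: diracT_eq1.
Qed.

End PartialIntegrals.

(** * Integrating out all variables but one *)

Section Duals.
Context (R : realType) (d : nat) (r : nat -> nat).
Variable mu : nat -> {finite_measure set R -> \bar R}.
Local Notation Omega := (d.-tuple R).
Variable Psi : cores R r.
Hypothesis LPsi : L2cores d mu Psi.
Implicit Types (F : Omega -> R) (w : R -> R).

Lemma pair_lrE F k l x i j : pair_lr mu F Psi k l x i j =
  pint mu (fun i => (l <= i)%N)
    (fun z => pint mu (fun i => (i < k)%N) (fun y => lrow Psi i y * F y) z * rcol Psi j z) x.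
Proof.
rewrite /pair_lr /pintmx mxE; congr (pint mu _ _ x); apply/funext => z.
rewrite mxE /rcol mulr_sumr; apply: eq_bigr => e _; rewrite !mxE; congr (_ * _).
congr (pint mu _ _ z); apply/funext => y; rewrite mxE /lrow mulr_suml.
by apply: eq_bigr => b _; rewrite !mxE.
Qed.

Section PullLeft.
Variables (F : Omega -> R) (k : nat).
Hypothesis kd : (k <= d)%N.
Hypothesis LF : F \in Lfun (prod_measure d mu) 2.

Let lF (i : 'I_(r k)) := pint mu (fun i => (i < k)%N) (fun y => lrow Psi i y * F y).

Let mlow (i : 'I_(r k)) : measurable_fun [set: Omega] (fun y => lrow Psi i y * F y).
Proof.
apply: measurable_funM; last exact: Lfun_measurable LF.
exact: Lfun_measurable (lrow_L2 i LPsi kd).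
Qed.

Lemma left_pint_measurable i : measurable_fun [set: Omega] (lF i).
Proof. exact: measurable_pint. Qed.

Lemma left_pint_depends i : depends_on (fun i => (k <= i)%N) (lF i).
Proof.
apply: (@depends_onS _ _ (fun i => true && ~~ (i < k)%N)).
  by move=> j _; rewrite -leqNgt.
apply: (@pint_depends _ _ _ _ xpredT); first exact: mlow.
by move=> x y xy; congr (_ * _); [congr (lrow Psi i _)|congr F];
  apply: eq_nthT => j j_d; exact: xy.
Qed.

Section Right.
Variables (i : 'I_(r k)) (q : Omega -> R).
Hypotheses (mq : measurable_fun [set: Omega] q)
  (qd : depends_on (fun i => (k <= i)%N) q).
Hypothesis Lq : (fun x => lrow Psi i x * q x) \in Lfun (prod_measure d mu) 2.

Let int : (pm d mu xpredT).-integrable setT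
  (EFin \o (fun x => (lrow Psi i x * F x) * q x)).
Proof.
rewrite pmT; have := L2_intM Lq LF; apply: eq_integrable => // x _ /=.
by rewrite mulrAC.
Qed.

Lemma integrable_pull_left : (pm d mu (fun j => (k <= j)%N)).-integrable setT
  (EFin \o (fun x => lF i x * q x)).
Proof.
apply: (integrable_pull (@split_T d k) (@disj_T k) (mlow i) mq _ int) => w x.
exact: (depends_splicer (@disj_T k)).
Qed.

Lemma L2ip_pull_left : L2ip (prod_measure d mu) (fun x => lrow Psi i x * q x) F =
  \int[pm d mu (fun j => (k <= j)%N)]_x (lF i x * q x).
Proof.
rewrite -(Rintegral_pull (@split_T d k) (@disj_T k) (mlow i) mq _ int); last first.
  by move=> w x; exact: (depends_splicer (@disj_T k)).
by rewrite pmT; apply: eq_Rintegral => x _; rewrite mulrAC.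
Qed.

End Right.
End PullLeft.

(** The two partial integrals together run over all variables, each exactly once; what remains is a
    scalar product on [Omega], whatever [x]. *)
Lemma pair_lr_const F k x i j : F \in Lfun (prod_measure d mu) 2 -> (k <= d)%N ->
  (fun x => lrow Psi i x * rcol Psi j x) \in Lfun (prod_measure d mu) 2 ->
  pair_lr mu F Psi k k x i j =
  L2ip (prod_measure d mu) (fun x => lrow Psi i x * rcol Psi j x) F.
Proof.
move=> LF kd Lq; have mr := Lfun_measurable (rcol_L2 j LPsi kd).
have rd := rcol_depends Psi j kd; have ld := left_pint_depends kd LF i.
rewrite pair_lrE L2ip_pull_left// pint_full//.
  by apply: measurable_funM => //; exact: left_pint_measurable.
by move=> y z yz; rewrite (ld _ _ yz) (rd _ _ yz).
Qed.

(* The function of [x_k] whose scalar product with [w] is the scalar product of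
   [F] with [w] in the [(i, j)] entry of core [k], the other cores being [Psi]. *)
Definition dual_core F k (i : 'I_(r k)) (j : 'I_(r k.+1)) : R -> R := fun y =>
  pair_lr mu F Psi k k.+1 [tuple of nseq d y] i j.

Section DualCore.
Variables (F : Omega -> R) (k : nat) (i : 'I_(r k)) (j : 'I_(r k.+1)).
Hypothesis kd : (k < d)%N.
Hypothesis LF : F \in Lfun (prod_measure d mu) 2.

Let lF := pint mu (fun i => (i < k)%N) (fun y => lrow Psi i y * F y).

Let mlF : measurable_fun [set: Omega] lF.
Proof. by apply: left_pint_measurable => //; exact: ltnW. Qed.

Let mr : measurable_fun [set: Omega] (rcol Psi j).
Proof. exact: Lfun_measurable (rcol_L2 j LPsi kd). Qed.

Let mlFr : measurable_fun [set: Omega] (fun z => lF z * rcol Psi j z).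
Proof. exact: measurable_funM. Qed.

(** Once the variables before and after [k] are integrated out, only [x_k] is left; this is why
    [dual_core] may use the point all of whose coordinates are [y]. *)
Lemma pair_lr_coord x : pair_lr mu F Psi k k.+1 x i j = dual_core F i j x`_k.
Proof.
rewrite /dual_core !pair_lrE.
apply: (@pint_depends _ _ _ _ (fun i => (k <= i)%N)) => //.
  move=> y z yz; rewrite (left_pint_depends (ltnW kd) LF i yz).
  congr (_ * _); apply: (rcol_depends Psi j kd) => l l_d kl.
  by apply: yz => //; exact: ltnW.
move=> l l_d; rewrite -ltnNge ltnS -eqn_leq => /eqP <-.
by rewrite nth_nseq kd.
Qed.

Lemma measurable_dual_core : measurable_fun setT (dual_core F i j).
Proof.
rewrite (_ : dual_core F i j = fun y => pint mu (fun i => (k.+1 <= i)%N)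
  (fun z => lF z * rcol Psi j z) [tuple of nseq d y]); last first.
  by apply/funext => y; rewrite /dual_core pair_lrE.
have mn : measurable_fun setT (fun y : R => [tuple of nseq d y]).
  apply: measurable_tupleP => l l_d /=.
  rewrite (_ : (fun _ => _) = id)//.
  by apply/funext => y; rewrite nth_nseq l_d.
exact: (measurableT_comp (measurable_pint mu (fun i => (k.+1 <= i)%N) mlFr) mn).
Qed.

(** Two applications of Fubini's theorem, over the variables before [k] and then over those after
    [k]. They rest on the integrability of the whole product, as [dual_core] is not yet known to be
    in L2. *)
Lemma L2ip_dual_core w : w \in Lfun (mu k) 2 ->
  L2ip (prod_measure d mu) (fun x => lrow Psi i x * (w x`_k * rcol Psi j x)) F =
  L2ip (mu k) w (dual_core F i j).
Proof.
move=> Lw; have mw := Lfun_measurable Lw.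
have mwk : measurable_fun [set: Omega] (fun x : Omega => w x`_k).
  exact: (measurableT_comp mw (measurable_nth kd)).
have mq : measurable_fun [set: Omega] (fun x : Omega => w x`_k * rcol Psi j x).
  exact: measurable_funM.
have qd : depends_on (fun i => (k <= i)%N) (fun x : Omega => w x`_k * rcol Psi j x).
  move=> x y xy; rewrite xy//; congr (_ * _).
  by apply: (rcol_depends Psi j kd) => // l l_d kl; apply: xy => //; exact: ltnW.
have Le := elem_L2 i j LPsi LPsi kd Lw.
have i1 := integrable_pull_left (ltnW kd) LF mq qd Le.
rewrite (L2ip_pull_left (ltnW kd) LF mq qd Le).
have sp l : (l < d)%N -> (k <= l)%N = (k.+1 <= l)%N || (l == k).
  by move=> _; rewrite leq_eqVlt orbC eq_sym.
have dj l : (k.+1 <= l)%N -> l != k by move=> /gtn_eqF ->.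
have wk y z : w (splice (fun l => (k.+1 <= l)%N) y z : Omega)`_k = w z`_k.
  by rewrite nth_splice// ltnn.
have eqf : (fun x => lF x * (w x`_k * rcol Psi j x)) =
           (fun x => lF x * rcol Psi j x * w x`_k).
  by apply/funext => x; rewrite mulrCA mulrC.
rewrite -/lF eqf in i1 *.
rewrite (Rintegral_pull sp dj mlFr mwk wk i1).
rewrite /L2ip (Rintegral_coord _ kd) ; last first.
  by apply: measurable_funM => //; exact: measurable_dual_core.
by apply: eq_Rintegral => x _; rewrite mulrC -pair_lr_coord pair_lrE.
Qed.

End DualCore.
End Duals.

(** * Gram matrices of the partial products *)

Section Gram.
Context (R : realType) (d : nat) (r : nat -> nat).
Variable mu : nat -> {finite_measure set R -> \bar R}.
Local Notation Omega := (d.-tuple R).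
Implicit Types (Psi A B V : cores R r) (w : R -> R).

Lemma L2ip_sum2 d' (T : measurableType d') (nu : {measure set T -> \bar R})
    (I J : finType) (f : I -> T -> R) (g : J -> T -> R) :
  (forall i, f i \in Lfun nu 2) -> (forall j, g j \in Lfun nu 2) ->
  L2ip nu (fun x => \sum_i f i x) (fun x => \sum_j g j x) =
  \sum_i \sum_j L2ip nu (f i) (g j).
Proof.
move=> Lf Lg; rewrite L2ip_suml//; last exact: L2sum.
apply: eq_bigr => i _; rewrite L2ipC L2ip_suml//.
by apply: eq_bigr => j _; rewrite L2ipC.
Qed.

Section LeftOrthonormal.
Variables (Psi : cores R r) (hr0 : r 0%N = 1%N) (LPsi : L2cores d mu Psi).

(** Each term factors into a product over the earlier variables, which is 0 or 1 by induction, and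
    one in [x_k]; the surviving diagonal terms add up to an entry of the Gram matrix of core [k]. At
    [k = 0], [r_0 = 1] leaves a single function, the constant 1, on a space of mass 1. *)
Lemma lrow_orthonormal k (a a' : 'I_(r k)) : (k <= d)%N ->
  (forall i, (i < k)%N -> Cmx (mu i) (Psi i) (Psi i) = 1%:M) ->
  L2ip (pm d mu (fun i => (i < k)%N)) (lrow Psi a) (lrow Psi a') = (a == a')%:R.
Proof.
elim: k a a' => [|k IHk] a a' kd CPsi.
  have -> : a = a'.
    have val0 (c : 'I_(r 0%N)) : nat_of_ord c = 0%N.
      by apply/eqP; rewrite -leqn0 -ltnS -[X in (_ < X)%N]hr0.
    by apply: val_inj; rewrite /= !val0.
  rewrite eqxx /L2ip; under eq_Rintegral do rewrite !lrow0 mulr1.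
  rewrite Rintegral_cst// [X in fine X]prod_measure_setT ?mulr1// => i i_d.
  exact: diracT_eq1.
have kd' := ltnW kd.
pose e (a : 'I_(r k.+1)) (m : 'I_(r k)) (x : Omega) := lrow Psi m x * Psi k x`_k m a.
have lE (a0 : 'I_(r k.+1)) : lrow Psi a0 = (fun x : Omega => \sum_m e a0 m x).
  by apply/funext => x; rewrite lrowS.
have Le a0 m : e a0 m \in Lfun (pm d mu (fun i => (i < k.+1)%N)) 2.
  apply: (L2_tensor (@split_ltS d k) (@disj_ltS k)).
  - exact: lrow_depends.
  - exact: (@coord_depends _ _ k (fun y => Psi k y m a0)).
  - exact: lrow_L2.
  - exact: (L2_coord _ (LPsi _ _ _)).
rewrite !lE L2ip_sum2//.
transitivity (Cmx (mu k) (Psi k) (Psi k) a a'); last by rewrite CPsi// mxE.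
rewrite mxE; apply: eq_bigr => m _; rewrite (bigD1 m)//= big1 ?addr0.
  rewrite (L2ip_tensor (@split_ltS d k) (@disj_ltS k)).
  - rewrite IHk// ?eqxx ?mul1r; last by move=> i ik; apply: CPsi; exact: ltnW.
    apply: (@L2ip_coord _ _ _ _ kd (fun y => Psi k y m a) (fun y => Psi k y m a')).
    + exact: Lfun_measurable (LPsi kd m a).
    + exact: Lfun_measurable (LPsi kd m a').
  - exact: lrow_depends.
  - exact: lrow_depends.
  - exact: (@coord_depends _ _ k (fun y => Psi k y m a)).
  - exact: (@coord_depends _ _ k (fun y => Psi k y m a')).
  - exact: lrow_L2.
  - exact: lrow_L2.
  - exact: (L2_coord _ (LPsi _ _ _)).
  - exact: (L2_coord _ (LPsi _ _ _)).
move=> m' m'm; rewrite (L2ip_tensor (@split_ltS d k) (@disj_ltS k)).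
- rewrite IHk//; last by move=> i ik; apply: CPsi; exact: ltnW.
  by rewrite eq_sym (negbTE m'm) mul0r.
- exact: lrow_depends.
- exact: lrow_depends.
- exact: (@coord_depends _ _ k (fun y => Psi k y m a)).
- exact: (@coord_depends _ _ k (fun y => Psi k y m' a')).
- exact: lrow_L2.
- exact: lrow_L2.
- exact: (L2_coord _ (LPsi _ _ _)).
- exact: (L2_coord _ (LPsi _ _ _)).
Qed.

Section Split.
Variable k : nat.
Hypothesis kd : (k < d)%N.
Hypothesis CPsi : forall i, (i < k)%N -> Cmx (mu i) (Psi i) (Psi i) = 1%:M.

Lemma right_depends A b w : depends_on (fun i => (k <= i)%N)
  (fun x : Omega => w x`_k * rcol A (k := k.+1) b x).
Proof.
move=> x y xy; rewrite xy//; congr (_ * _); apply: (rcol_depends A b) => //.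
by move=> i i_d ki; apply: xy => //; exact: ltnW.
Qed.

Lemma right_L2 A b w : L2cores d mu A -> w \in Lfun (mu k) 2 ->
  (fun x : Omega => w x`_k * rcol A (k := k.+1) b x) \in
    Lfun (pm d mu (fun i => (k <= i)%N)) 2.
Proof.
move=> LA Lw; apply: (L2_tensor (@split_leS d k) (@disj_leS k)).
- exact: coord_depends.
- exact: rcol_depends.
- exact: L2_coord.
- exact: rcol_L2.
Qed.

Lemma L2ip_elem A B a a' b b' w w' : L2cores d mu A -> L2cores d mu B ->
  w \in Lfun (mu k) 2 -> w' \in Lfun (mu k) 2 ->
  L2ip (prod_measure d mu)
    (fun x => lrow Psi (k := k) a x * (w x`_k * rcol A (k := k.+1) b x))
    (fun x => lrow Psi (k := k) a' x * (w' x`_k * rcol B (k := k.+1) b' x)) =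
  (a == a')%:R * (L2ip (mu k) w w' *
    L2ip (pm d mu (fun i => (k < i)%N)) (rcol A b) (rcol B b')).
Proof.
move=> LA LB Lw Lw'; rewrite -pmT (L2ip_tensor (@split_T d k) (@disj_T k)).
- rewrite lrow_orthonormal//; last exact: ltnW.
  congr (_ * _); rewrite (L2ip_tensor (@split_leS d k) (@disj_leS k)).
  + by rewrite (L2ip_coord mu kd (Lfun_measurable Lw) (Lfun_measurable Lw')).
  + exact: coord_depends.
  + exact: coord_depends.
  + exact: rcol_depends.
  + exact: rcol_depends.
  + exact: L2_coord.
  + exact: L2_coord.
  + exact: rcol_L2.
  + exact: rcol_L2.
- exact/lrow_depends/ltnW.
- exact/lrow_depends/ltnW.
- exact: right_depends.
- exact: right_depends.
- exact/lrow_L2/ltnW.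
- exact/lrow_L2/ltnW.
- exact: right_L2.
- exact: right_L2.
Qed.

(** Only the cores before [k] are shared. With [k] the replaced core on both sides this gives the
    squared norms of the tangent terms; with [k] the smaller of two replaced positions it gives
    their orthogonality. *)
Lemma L2ip_ftt A B : L2cores d mu A -> L2cores d mu B ->
  (forall i, (i < k)%N -> A i = Psi i) -> (forall i, (i < k)%N -> B i = Psi i) ->
  L2ip (prod_measure d mu) (ftt A) (ftt B) = \sum_b \sum_b'
    Cmx (mu k) (A k) (B k) b b' *
    L2ip (pm d mu (fun i => (k < i)%N)) (rcol A b) (rcol B b').
Proof.
move=> LA LB APsi BPsi.
have fE C : (forall i, (i < k)%N -> C i = Psi i) -> ftt C =
    (fun x : Omega => \sum_(p : 'I_(r k) * 'I_(r k.+1))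
       lrow Psi p.1 x * (C k x`_k p.1 p.2 * rcol C p.2 x)).
  move=> CPsi'; apply/funext => x; rewrite (fttE _ _ kd) pair_big/=.
  by apply: eq_bigr => p _; rewrite (eq_lrow (B := Psi)).
rewrite (fE _ APsi) (fE _ BPsi) L2ip_sum2; last 2 first.
- by move=> p; apply: (elem_L2 _ _ LPsi LA kd (w := fun y => A k y p.1 p.2)); exact: LA.
- by move=> p; apply: (elem_L2 _ _ LPsi LB kd (w := fun y => B k y p.1 p.2)); exact: LB.
have key (p q : 'I_(r k) * 'I_(r k.+1)) : L2ip (prod_measure d mu)
    (fun x => lrow Psi p.1 x * (A k x`_k p.1 p.2 * rcol A p.2 x))
    (fun x => lrow Psi q.1 x * (B k x`_k q.1 q.2 * rcol B q.2 x)) =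
  (p.1 == q.1)%:R * (L2ip (mu k) (fun y => A k y p.1 p.2) (fun y => B k y q.1 q.2) *
    L2ip (pm d mu (fun i => (k < i)%N)) (rcol A p.2) (rcol B q.2)).
  exact: (@L2ip_elem A B p.1 q.1 p.2 q.2
    (fun y => A k y p.1 p.2) (fun y => B k y q.1 q.2) LA LB (LA _ _ _ _) (LB _ _ _ _)).
under eq_bigr do under eq_bigr do rewrite key.
rewrite -(pair_big xpredT xpredT (fun a b => \sum_(q : 'I_(r k) * 'I_(r k.+1))
   (a == q.1)%:R * (L2ip (mu k) (fun y => A k y a b) (fun y => B k y q.1 q.2) *
    L2ip (pm d mu (fun i => (k < i)%N)) (rcol A b) (rcol B q.2))))/=.
have inner a b : \sum_(q : 'I_(r k) * 'I_(r k.+1))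
    (a == q.1)%:R * (L2ip (mu k) (fun y => A k y a b) (fun y => B k y q.1 q.2) *
      L2ip (pm d mu (fun i => (k < i)%N)) (rcol A b) (rcol B q.2)) =
    \sum_b' L2ip (mu k) (fun y => A k y a b) (fun y => B k y a b') *
      L2ip (pm d mu (fun i => (k < i)%N)) (rcol A b) (rcol B b').
  rewrite -(pair_big xpredT xpredT (fun a' b' =>
    (a == a')%:R * (L2ip (mu k) (fun y => A k y a b) (fun y => B k y a' b') *
      L2ip (pm d mu (fun i => (k < i)%N)) (rcol A b) (rcol B b'))))/=.
  rewrite (bigD1 a)//= [X in _ + X]big1 ?addr0.
    by apply: eq_bigr => b' _; rewrite eqxx mul1r.
  by move=> a' aa'; apply: big1 => b' _; rewrite eq_sym (negbTE aa') mul0r.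
rewrite exchange_big/=; apply: eq_bigr => b _.
under eq_bigr do rewrite inner.
rewrite exchange_big/=; apply: eq_bigr => b' _.
by rewrite mxE mulr_suml.
Qed.

(** By the Cauchy-Schwarz inequality the pairing with [w] is at most the norm of [F] times that of
    an elementary term; as the left factor has norm 1, the latter is the norm of [w] times that of
    [rcol Psi b]. *)
Lemma dual_core_L2 F a b : F \in Lfun (prod_measure d mu) 2 ->
  dual_core mu Psi F (k := k) a b \in Lfun (mu k) 2.
Proof.
move=> LF; apply: (@L2_of_dual_bound _ _ _ _ _
  (L2ip (pm d mu (fun i => (k < i)%N)) (rcol Psi b) (rcol Psi b) *
   L2ip (prod_measure d mu) F F)).
- exact: measurable_dual_core.
- by rewrite mulr_ge0// L2ip_ge0.
move=> w Lw; rewrite -L2ip_dual_core//.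
apply: le_trans (L2ip_CS (elem_L2 a b LPsi LPsi kd Lw) LF) _.
by rewrite L2ip_elem// eqxx mul1r -mulrA mulrC.
Qed.

End Split.
End LeftOrthonormal.

Lemma sum1M n (F G : 'I_n -> R) : n = 1%N ->
  (\sum_i F i) * (\sum_i G i) = \sum_i F i * G i.
Proof. by move=> n1; subst n; rewrite !big_ord1. Qed.

Lemma CPhiE Psi k (x : Omega) b b' : L2cores d mu Psi -> r d = 1%N -> (k <= d)%N ->
  CPhi mu Psi k x b b' =
  L2ip (pm d mu (fun i => (k <= i)%N)) (rcol Psi b) (rcol Psi b').
Proof.
move=> LPsi rd kd; rewrite /CPhi /pintmx mxE.
rewrite (_ : (fun z => _) = fun z : Omega => rcol Psi b z * rcol Psi b' z); last first.
  apply/funext => z; rewrite mxE /rcol sum1M//.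
  by apply: eq_bigr => i _; rewrite mxE.
rewrite pint_full//.
  by apply: measurable_funM; exact: Lfun_measurable (rcol_L2 _ LPsi kd).
by move=> y z yz; rewrite (rcol_depends Psi b kd yz) (rcol_depends Psi b' kd yz).
Qed.

End Gram.

(** * Derivative of the tensor along a curve of cores *)

Section ProductRule.
Context (R : realType) (d : nat) (r : nat -> nat).
Variable mu : nat -> {finite_measure set R -> \bar R}.
Local Notation Omega := (d.-tuple R).
Implicit Types (Psi V : cores R r).

Definition dftt Psi V : Omega -> R := fun x => \sum_(k < d) ftt (upd Psi V k) x.

Lemma L2curve_derive_coord k (c : R -> R -> R) p g : (k < d)%N ->
  L2curve_derive (mu k) c p g ->
  L2curve_derive (pm d mu (fun i => i == k))
    (fun h (x : Omega) => c h x`_k) (fun x => p x`_k) (fun x => g x`_k).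
Proof.
move=> kd [Lp Lg Lc cg]; split; [exact: L2_coord|exact: L2_coord| |].
  by near=> h; apply: L2_coord => //; near: h.
apply: cvg_trans cg; apply: near_eq_cvg; near=> h.
have Lch : c h \in Lfun (mu k) 2 by near: h.
have mq := Lfun_measurable (L2quot_L2 Lch Lp Lg).
by rewrite -(L2ip_coord mu kd mq mq).
Unshelve. all: by end_near. Qed.

Variables (P : R -> cores R r) (Psi V : cores R r).
Hypothesis PV : forall i, (i < d)%N -> forall j l, L2curve_derive (mu i)
  (fun h y => P h i y j l) (fun y => Psi i y j l) (fun y => V i y j l).

(** Induction on the number of cores: core [k] depends on a variable absent from the product of the
    earlier ones, so the product rule for disjoint variables applies. *)
Lemma L2curve_derive_lrow k (a : 'I_(r k)) : (k <= d)%N ->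
  L2curve_derive (pm d mu (fun i => (i < k)%N)) (fun h => lrow (P h) a)
    (lrow Psi a) (fun x => \sum_(j < k) lrow (upd Psi V j) a x).
Proof.
elim: k a => [|k IHk] a kd.
  rewrite (_ : (fun h => _) = fun=> cst 1); last first.
    by apply/funext => h; apply/funext => x; rewrite lrow0.
  rewrite (_ : lrow Psi a = cst 1); last by apply/funext => x; rewrite lrow0.
  rewrite (_ : (fun x => \sum_(j < 0) _) = fun=> 0); last by apply/funext => x; rewrite big_ord0.
  by apply: L2curve_derive_cst; exact: Lfun_cst.
have kd' := ltnW kd.
rewrite (_ : (fun h => _) = fun h (x : Omega) =>
    \sum_(m < r k) lrow (P h) m x * P h k x`_k m a); last first.
  by apply/funext => h; apply/funext => x; rewrite lrowS.
rewrite (_ : lrow Psi a = fun x : Omega =>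
    \sum_(m < r k) lrow Psi m x * Psi k x`_k m a); last first.
  by apply/funext => x; rewrite lrowS.
rewrite (_ : (fun x => \sum_(j < k.+1) _) = fun x : Omega => \sum_(m < r k)
   ((\sum_(j < k) lrow (upd Psi V j) m x) * Psi k x`_k m a +
    lrow Psi m x * V k x`_k m a)); last first.
  (* The terms [j < k] keep core [k] of [Psi]; the last term, [j = k], keeps all the earlier
     cores. *)
  apply/funext => x; rewrite big_ord_recr/= big_split/=; congr (_ + _).
    under [RHS]eq_bigr do rewrite mulr_suml.
    rewrite [RHS]exchange_big/=; apply: eq_bigr => j _; rewrite lrowS.
    by apply: eq_bigr => m _; rewrite /upd gtn_eqF.
  rewrite lrowS; apply: eq_bigr => m _; congr (_ * _); last by rewrite /upd eqxx.
  by apply: eq_lrow => i ik; rewrite /upd ltn_eqF.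
apply: L2curve_derive_sum => m _.
apply: (L2curve_derive_tensor (@split_ltS d k) (@disj_ltS k)).
- by move=> h; exact: lrow_depends.
- exact: lrow_depends.
- by move=> x y xy; apply: eq_bigr => j _; exact: lrow_depends xy.
- by move=> h; exact: (@coord_depends _ _ k (fun y => P h k y m a)).
- exact: (@coord_depends _ _ k (fun y => Psi k y m a)).
- exact: (@coord_depends _ _ k (fun y => V k y m a)).
- exact: IHk.
- exact: (L2curve_derive_coord kd (PV kd m a)).
Qed.

Lemma ftt_lrow A (x : Omega) : ftt A x = \sum_(j < r d) lrow A j x.
Proof. by rewrite /ftt exchange_big. Qed.

Lemma L2curve_derive_ftt : L2curve_derive (prod_measure d mu)
  (fun h => ftt (P h)) (ftt Psi) (dftt Psi V).
Proof.
rewrite -pmT (@eq_pm _ _ _ _ (fun i => (i < d)%N)); last by move=> i ->.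
have fE A : ftt A = (fun x : Omega => \sum_(j < r d) lrow A j x).
  by apply/funext => x; exact: ftt_lrow.
rewrite (_ : (fun h => _) = fun h (x : Omega) => \sum_(j < r d) lrow (P h) j x); last first.
  by apply/funext => h; rewrite fE.
rewrite fE (_ : dftt _ _ = fun x => \sum_(j < r d) \sum_(k < d) lrow (upd Psi V k) j x).
  by apply: L2curve_derive_sum => j _; exact: L2curve_derive_lrow.
apply/funext => x; rewrite /dftt [RHS]exchange_big/=.
by apply: eq_bigr => k _; rewrite ftt_lrow.
Qed.

End ProductRule.

(** * Tangent vectors *)

Section Tangent.
Context (R : realType) (d : nat) (r : nat -> nat).
Variable mu : nat -> {finite_measure set R -> \bar R}.
Local Notation Omega := (d.-tuple R).
Local Notation nu := (prod_measure d mu).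
Variable Psi : cores R r.
Hypotheses (hr0 : r 0%N = 1%N) (hrd : r d = 1%N).
Hypothesis LPsi : L2cores d mu Psi.
Hypothesis hPsi : forall i, (i.+1 < d)%N -> Cmx (mu i) (Psi i) (Psi i) = 1%:M.
Hypothesis hPhi : forall k, (0 < k < d)%N -> forall x : Omega,
  CPhi mu Psi k x \in unitmx.
Implicit Types (V W A B : cores R r) (F : Omega -> R).

(** The gauge condition, put on a velocity instead of a curve. *)
Definition orthogonal_cores W := forall k, (k.+1 < d)%N ->
  Cmx (mu k) (W k) (Psi k) = 0.

Lemma CPsi k : (k < d)%N ->
  forall i, (i < k)%N -> Cmx (mu i) (Psi i) (Psi i) = 1%:M.
Proof. by move=> kd i ik; apply: hPsi; exact: leq_trans kd. Qed.

Lemma ftt_L2 A : L2cores d mu A -> ftt A \in Lfun nu 2.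
Proof.
move=> LA; rewrite (_ : ftt A = fun x => \sum_(j < r d) lrow A j x); last first.
  by apply/funext => x; exact: ftt_lrow.
apply: L2sum => j _; rewrite -pmT (@eq_pm _ _ _ _ (fun i => (i < d)%N)).
  exact: lrow_L2.
by move=> i ->.
Qed.

Lemma dftt_L2 W : L2cores d mu W -> dftt Psi W \in Lfun nu 2.
Proof. by move=> LW; apply: L2sum => k _; apply: ftt_L2; exact: L2cores_upd. Qed.

Lemma ftt_updE W k (x : Omega) : (k < d)%N -> ftt (upd Psi W k) x =
  \sum_(a < r k) \sum_(b < r k.+1) lrow Psi a x * (W k x`_k a b * rcol Psi b x).
Proof.
move=> kd; rewrite (fttE _ _ kd); apply: eq_bigr => a _; apply: eq_bigr => b _.
congr (_ * (_ * _)).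
- by apply: eq_lrow => i ik; rewrite /upd ltn_eqF.
- by rewrite /upd eqxx.
- by apply: eq_rcol => i ki; rewrite /upd gtn_eqF.
Qed.

Lemma dfttB V W (x : Omega) : dftt Psi (fun k y => W k y - V k y) x = dftt Psi W x - dftt Psi V x.
Proof.
rewrite /dftt -sumrB; apply: eq_bigr => k _; rewrite !ftt_updE// -sumrB.
apply: eq_bigr => a _; rewrite -sumrB; apply: eq_bigr => b _.
by rewrite !mxE; ring.
Qed.

Lemma L2ip_ftt_upd F W k : F \in Lfun nu 2 -> L2cores d mu W -> (k < d)%N ->
  L2ip nu (ftt (upd Psi W k)) F =
  \sum_a \sum_b L2ip (mu k) (fun y => W k y a b) (dual_core mu Psi F a b).
Proof.
move=> LF LW kd.
rewrite (_ : ftt _ = fun x => \sum_(a < r k) \sum_(b < r k.+1)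
  lrow Psi a x * (W k x`_k a b * rcol Psi b x)); last first.
  by apply/funext => x; exact: ftt_updE.
have Le a b := elem_L2 a b LPsi LPsi kd (LW _ kd a b).
rewrite L2ip_suml//; last by move=> a _; apply: L2sum => b _; exact: Le.
apply: eq_bigr => a _; rewrite L2ip_suml//.
by apply: eq_bigr => b _; rewrite (L2ip_dual_core LPsi a b kd LF (LW _ kd a b)).
Qed.

Lemma L2ip_dftt F W : F \in Lfun nu 2 -> L2cores d mu W ->
  L2ip nu (dftt Psi W) F = \sum_(k < d) \sum_a \sum_b
    L2ip (mu k) (fun y => W k y a b) (dual_core mu Psi F a b).
Proof.
move=> LF LW; rewrite L2ip_suml//; last first.
  by move=> k _; apply: ftt_L2; exact: L2cores_upd.
by apply: eq_bigr => k _; exact: L2ip_ftt_upd.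
Qed.

(** The matrix [CPhi] at [k.+1], without its dummy point. *)
Definition right_gram k : 'M[R]_(r k.+1) := \matrix_(b, b')
  L2ip (pm d mu (fun i => (k < i)%N)) (rcol Psi b) (rcol Psi b').

Lemma right_gramE k (x : Omega) : (k < d)%N -> right_gram k = CPhi mu Psi k.+1 x.
Proof. by move=> kd; apply/matrixP => b b'; rewrite mxE CPhiE. Qed.

(** The right product is empty, hence the constant 1, and all variables are frozen by Dirac
    masses. *)
Lemma right_gram_last k : k.+1 = d -> right_gram k = 1%:M.
Proof.
move=> kd; apply/matrixP => b b'; rewrite !mxE /L2ip.
under eq_Rintegral do rewrite !rcol_last// mulr1.
rewrite Rintegral_cst// [X in fine X]prod_measure_setT.
  have val0 (c : 'I_(r k.+1)) : nat_of_ord c = 0%N.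
    by apply/eqP; rewrite -leqn0 -ltnS -[X in (_ < X)%N]hrd -kd.
  by rewrite (_ : b == b') ?mulr1// -val_eqE /= !val0.
move=> i; rewrite -kd => i_d; rewrite ltnNge -ltnS i_d; exact: diracT_eq1.
Qed.

Lemma right_gram_unit k : (k < d)%N -> right_gram k \in unitmx.
Proof.
move=> kd; have [k1d|dk1] := ltnP k.+1 d.
  by rewrite (right_gramE [tuple of nseq d 0])// hPhi.
by rewrite right_gram_last ?unitmx1//; apply/eqP; rewrite eqn_leq kd.
Qed.

Lemma upd_lt A B k i : (i < k)%N -> upd A B k i = A i.
Proof. by move=> ik; rewrite /upd ltn_eqF. Qed.

Lemma L2ip_ftt_diag V W k : L2cores d mu V -> L2cores d mu W -> (k < d)%N ->
  L2ip nu (ftt (upd Psi V k)) (ftt (upd Psi W k)) =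
  \sum_b \sum_b' Cmx (mu k) (V k) (W k) b b' * right_gram k b b'.
Proof.
move=> LV LW kd; rewrite (L2ip_ftt hr0 LPsi kd (CPsi kd)); last 4 first.
- exact: L2cores_upd.
- exact: L2cores_upd.
- by move=> i; exact: upd_lt.
- by move=> i; exact: upd_lt.
apply: eq_bigr => b _; apply: eq_bigr => b' _; congr (_ * _).
  by rewrite /upd eqxx.
rewrite mxE; congr (L2ip _ _ _); apply/funext => x;
  by apply: eq_rcol => i ki; rewrite /upd gtn_eqF.
Qed.

(** Split at the smaller position [j]: there one tensor has the core [V j], the other still has
    [Psi j], and the gauge makes their Gram matrix vanish. As [j < k < d], the core [j] is never the
    last one. *)
Lemma L2ip_ftt_cross V W j k : L2cores d mu V -> L2cores d mu W ->
  (j < k < d)%N -> orthogonal_cores V ->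
  L2ip nu (ftt (upd Psi V j)) (ftt (upd Psi W k)) = 0.
Proof.
move=> LV LW /andP[jk kd] oV; have jd := ltn_trans jk kd.
rewrite (L2ip_ftt hr0 LPsi jd (CPsi jd)); last 4 first.
- exact: L2cores_upd.
- exact: L2cores_upd.
- by move=> i; exact: upd_lt.
- by move=> i ij; apply: upd_lt; exact: ltn_trans jk.
rewrite big1// => b _; rewrite big1// => b' _.
by rewrite /upd eqxx ltn_eqF// oV ?mxE ?mul0r//; exact: leq_ltn_trans kd.
Qed.

Lemma L2ip_dftt_dftt V W : L2cores d mu V -> L2cores d mu W ->
  orthogonal_cores V -> orthogonal_cores W ->
  L2ip nu (dftt Psi V) (dftt Psi W) =
  \sum_(k < d) L2ip nu (ftt (upd Psi V k)) (ftt (upd Psi W k)).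
Proof.
move=> LV LW oV oW.
rewrite (L2ip_sum2 (f := fun k : 'I_d => ftt (upd Psi V k))
                   (g := fun k : 'I_d => ftt (upd Psi W k))); last 2 first.
- by move=> k; apply: ftt_L2; exact: L2cores_upd.
- by move=> k; apply: ftt_L2; exact: L2cores_upd.
apply: eq_bigr => k _; rewrite (bigD1 k)//= big1 ?addr0// => j.
rewrite -val_eqE neq_ltn => /orP[jk|kj].
  by rewrite L2ipC L2ip_ftt_cross//; apply/andP; split.
by rewrite L2ip_ftt_cross//; apply/andP; split.
Qed.

Definition L2mx k p q (A : R -> 'M[R]_(p, q)) :=
  forall i j, (fun y => A y i j) \in Lfun (mu k) 2.

Lemma L2mx_mulr k p q (A : R -> 'M[R]_(p, q)) (M : 'M[R]_q) :
  L2mx k A -> L2mx k (fun y => A y *m M).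
Proof.
move=> LA i j; rewrite (_ : (fun y => _) = fun y => \sum_m M m j * A y i m).
  by apply: L2sum => m _; exact: L2Z.
by apply/funext => y; rewrite mxE; apply: eq_bigr => m _; rewrite mulrC.
Qed.

Lemma L2mxB k p q (A B : R -> 'M[R]_(p, q)) :
  L2mx k A -> L2mx k B -> L2mx k (fun y => A y - B y).
Proof.
move=> LA LB i j; rewrite (_ : (fun y => _) = fun y => A y i j - B y i j).
  exact: L2B.
by apply/funext => y; rewrite !mxE.
Qed.

Lemma tr_Cmx k p q (A B : R -> 'M[R]_(p, q)) : (Cmx (mu k) A B)^T = Cmx (mu k) B A.
Proof.
by apply/matrixP => i j; rewrite !mxE; apply: eq_bigr => m _; rewrite L2ipC.
Qed.

Lemma Cmx_mulr k p q (A B : R -> 'M[R]_(p, q)) (M : 'M[R]_q) :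
  L2mx k A -> L2mx k B ->
  Cmx (mu k) A (fun y => B y *m M) = Cmx (mu k) A B *m M.
Proof.
move=> LA LB; apply/matrixP => i j; rewrite !mxE.
under [RHS]eq_bigr do rewrite mxE mulr_suml.
rewrite [RHS]exchange_big/=; apply: eq_bigr => a _.
rewrite L2ipC (_ : (fun y => _) = fun y => \sum_m M m j * B y a m); last first.
  by apply/funext => y; rewrite mxE; apply: eq_bigr => m _; rewrite mulrC.
rewrite L2ip_suml//; last by move=> m _; exact: L2Z.
by apply: eq_bigr => m _; rewrite L2ipZl// L2ipC mulrC.
Qed.

Lemma CmxBr k p q (A B B' : R -> 'M[R]_(p, q)) :
  L2mx k A -> L2mx k B -> L2mx k B' ->
  Cmx (mu k) A (fun y => B y - B' y) = Cmx (mu k) A B - Cmx (mu k) A B'.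
Proof.
move=> LA LB LB'; apply/matrixP => i j; rewrite !mxE -sumrB.
apply: eq_bigr => a _; rewrite L2ipC.
rewrite (_ : (fun y => _) = fun y => B y a j - B' y a j); last first.
  by apply/funext => y; rewrite !mxE.
by rewrite L2ipBl// !(L2ipC _ _ (fun y => A y a i)).
Qed.

Lemma tr_CmxE k p q (A B : R -> 'M[R]_(p, q)) :
  \tr (Cmx (mu k) A B) = \sum_a \sum_b L2ip (mu k) (fun y => A y a b) (fun y => B y a b).
Proof. by rewrite exchange_big/=; apply: eq_bigr => b _; rewrite mxE. Qed.

Lemma tr_right_gram k : (right_gram k)^T = right_gram k.
Proof. by apply/matrixP => b b'; rewrite !mxE L2ipC. Qed.

Lemma tr_mul_right_gram k (X : 'M[R]_(r k.+1)) :
  \sum_b \sum_b' X b b' * right_gram k b b' = \tr (X *m right_gram k).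
Proof.
apply: eq_bigr => b _; rewrite [RHS]mxE; apply: eq_bigr => b' _.
by rewrite -[in RHS]tr_right_gram [in RHS]mxE.
Qed.

(** This is [T_k(F)]: it represents the functional [W |-> <F, D W>] on the velocities of core
    [k]. *)
Definition dual_mx F k : R -> 'M[R]_(r k, r k.+1) :=
  fun y => \matrix_(a, b) dual_core mu Psi F a b y.

Lemma dual_mx_L2 F k : F \in Lfun nu 2 -> (k < d)%N -> L2mx k (dual_mx F k).
Proof.
move=> LF kd a b; rewrite (_ : (fun y => _) = dual_core mu Psi F a b).
  exact: (dual_core_L2 hr0 LPsi kd (CPsi kd)).
by apply/funext => y; rewrite mxE.
Qed.

Lemma L2ip_dftt_tr F W : F \in Lfun nu 2 -> L2cores d mu W ->
  L2ip nu (dftt Psi W) F = \sum_(k < d) \tr (Cmx (mu k) (W k) (dual_mx F k)).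
Proof.
move=> LF LW; rewrite L2ip_dftt//; apply: eq_bigr => k _; rewrite tr_CmxE.
apply: eq_bigr => a _; apply: eq_bigr => b _; congr (L2ip _ _ _).
by apply/funext => y; rewrite mxE.
Qed.

(** The left product of length [k.+1] is that of length [k] times [Psi k]; so pairing [T_k(F)] with
    [Psi k] integrates out the one remaining variable. *)
Lemma Cmx_dual_mx F k x : F \in Lfun nu 2 -> (k < d)%N ->
  Cmx (mu k) (Psi k) (dual_mx F k) = pair_lr mu F Psi k.+1 k.+1 x.
Proof.
move=> LF kd; apply/matrixP => m c.
have Le a := elem_L2 a c LPsi LPsi kd (LPsi kd a m).
have lE : (fun x : Omega => lrow Psi m x * rcol Psi c x) =
    (fun x => \sum_a lrow Psi a x * (Psi k x`_k a m * rcol Psi c x)).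
  apply/funext => z; rewrite lrowS mulr_suml.
  by apply: eq_bigr => a _; rewrite mulrA.
rewrite pair_lr_const//; last by rewrite lE; exact: L2sum.
rewrite lE L2ip_suml// mxE; apply: eq_bigr => a _.
rewrite (L2ip_dual_core LPsi a c kd LF (LPsi kd a m)); congr (L2ip _ _ _).
by apply/funext => y; rewrite mxE.
Qed.

Variable Nu : Omega -> R.
Hypothesis LNu : Nu \in Lfun nu 2.

Definition pde_velocity : cores R r := fun k y =>
  if (k.+1 < d)%N then
    (dual_mx Nu k y - Psi k y *m Cmx (mu k) (Psi k) (dual_mx Nu k))
      *m invmx (right_gram k)
  else dual_mx Nu k y.

Local Notation V := pde_velocity.

Lemma pde_velocity_lt k : (k.+1 < d)%N -> V k = fun y =>
  (dual_mx Nu k y - Psi k y *m Cmx (mu k) (Psi k) (dual_mx Nu k))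
      *m invmx (right_gram k).
Proof. by move=> kd; apply/funext => y; rewrite /V kd. Qed.

Lemma pde_velocity_last k : k.+1 = d -> V k = dual_mx Nu k.
Proof. 
move=> kd; apply/funext => y; rewrite /V; case: ifP => // k1d.
by move: (k1d); rewrite [X in (X < _)%N]kd ltnn.
 Qed.

Lemma pde_velocity_L2 : L2cores d mu V.
Proof.
move=> k kd; have LT := dual_mx_L2 LNu kd; have LP := LPsi kd.
have [k1d|dk1] := ltnP k.+1 d.
  rewrite (pde_velocity_lt k1d); apply: L2mx_mulr; apply: L2mxB => //.
  exact: L2mx_mulr.
by rewrite pde_velocity_last//; apply/eqP; rewrite eqn_leq kd.
Qed.

(** The subtracted term is the projection of [dual_mx Nu k] on the columns of [Psi k], which are
    orthonormal; multiplication on the right by a constant matrix preserves orthogonality to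
    them. *)
Lemma pde_velocity_orthogonal : orthogonal_cores V.
Proof.
move=> k k1d; have kd := ltnW k1d.
have LT := dual_mx_L2 LNu kd; have LP := LPsi kd.
rewrite -tr_Cmx (pde_velocity_lt k1d) Cmx_mulr//; last first.
  by apply: L2mxB => //; exact: L2mx_mulr.
rewrite CmxBr//; last exact: L2mx_mulr.
by rewrite Cmx_mulr// hPsi// mul1mx subrr mul0mx trmx0.
Qed.

(** Core by core, the factor [right_gram k] of the diagonal scalar products cancels the inverse in
    [V], and the gauge of [W] removes the projection; what is left pairs [W k] with [T_k(Nu)]. *)
Lemma L2ip_pde_velocity W : L2cores d mu W -> orthogonal_cores W ->
  L2ip nu (dftt Psi V) (dftt Psi W) = L2ip nu Nu (dftt Psi W).
Proof.
move=> LW oW; rewrite L2ipC [RHS]L2ipC [RHS]L2ip_dftt_tr//.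
rewrite L2ip_dftt_dftt//; [|exact: pde_velocity_L2|exact: pde_velocity_orthogonal].
apply: eq_bigr => k _; rewrite L2ip_ftt_diag//; last exact: pde_velocity_L2.
have LT := dual_mx_L2 LNu (ltn_ord k); have LP := LPsi (ltn_ord k).
have LWk := LW k (ltn_ord k).
rewrite tr_mul_right_gram; have [k1d|dk1] := ltnP k.+1 d.
  rewrite (pde_velocity_lt k1d) Cmx_mulr//; last first.
    by apply: L2mxB => //; exact: L2mx_mulr.
  rewrite CmxBr//; last exact: L2mx_mulr.
  rewrite Cmx_mulr// oW// mul0mx subr0 -mulmxA mulVmx ?mulmx1//.
  exact: right_gram_unit.
have kd : k.+1 = d by apply/eqP; rewrite eqn_leq ltn_ord.
by rewrite pde_velocity_last// right_gram_last// mulmx1.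
Qed.

(** With [G] the Gram matrix [right_gram k], the squared norm of the [k]-th term is the trace of
    [<W_k^T, W_k> G]. Testing this term against the one built from [W_k G] gives [|W_k G|^2], so no
    square root of [G] is needed, only its invertibility. *)
Lemma dftt_definite W : L2cores d mu W -> orthogonal_cores W ->
  L2ip nu (dftt Psi W) (dftt Psi W) = 0 ->
  forall k, (k < d)%N -> forall a b, (fun y => W k y a b) = cst 0 %[ae mu k].
Proof.
move=> LW oW; rewrite L2ip_dftt_dftt// => /eqP.
rewrite psumr_eq0; last by move=> k _; exact: L2ip_ge0.
move=> /allP W0 k kd.
have {}W0 : L2ip nu (ftt (upd Psi W k)) (ftt (upd Psi W k)) = 0.
  by have /implyP /(_ isT)/eqP := W0 (Ordinal kd) (mem_index_enum _).
have LWk := LW _ kd.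
pose Y : cores R r := fun i y => W i y *m right_gram i.
have LY : L2cores d mu Y by move=> i i_d; apply: L2mx_mulr; exact: LW.
(* The first factor has norm 0: Cauchy-Schwarz. *)
have : L2ip nu (ftt (upd Psi W k)) (ftt (upd Psi Y k)) = 0.
  apply/eqP; rewrite -sqrf_eq0 eq_le sqr_ge0 andbT.
  apply: le_trans (L2ip_CS _ _) _; first by apply: ftt_L2; exact: L2cores_upd.
    by apply: ftt_L2; exact: L2cores_upd.
  by rewrite W0 mul0r.
rewrite L2ip_ftt_diag// tr_mul_right_gram -mxtrace_tr trmx_mul tr_right_gram tr_Cmx.
rewrite mxtrace_mulC -Cmx_mulr//; last exact: LY.
rewrite tr_CmxE => /eqP; rewrite psumr_eq0; last first.
  by move=> a _; apply: sumr_ge0 => b _; exact: L2ip_ge0.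
move=> /allP Y0.
have {}Y0 a b : (fun y => Y k y a b) = cst 0 %[ae mu k].
  apply: L2ip_eq0; first exact: LY.
  have /implyP /(_ isT) := Y0 a (mem_index_enum _).
  rewrite psumr_eq0 => [/allP/(_ b (mem_index_enum _))/implyP/(_ isT)/eqP//|b' _].
  exact: L2ip_ge0.
move=> a b.
have : \forall y \ae mu k, forall b, Y k y a b = 0.
  by apply: filter_forall => b'; apply: filterS (Y0 a b') => y /(_ I).
apply: filterS => y Yy _ /=.
have -> : W k y = Y k y *m invmx (right_gram k).
  by rewrite mulmxK//; exact: right_gram_unit.
by rewrite mxE big1// => m _; rewrite Yy mul0r.
Qed.

Definition residual : Omega -> R := fun x => dftt Psi V x - Nu x.

Lemma residual_L2 : residual \in Lfun nu 2.
Proof. by apply: L2B => //; apply: dftt_L2; exact: pde_velocity_L2. Qed.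

Lemma L2ip_residual W : L2cores d mu W -> orthogonal_cores W ->
  L2ip nu (dftt Psi W) residual = 0.
Proof.
move=> LW oW; have LV := dftt_L2 pde_velocity_L2; have LDW := dftt_L2 LW.
by rewrite L2ipC L2ipBl// L2ip_pde_velocity// subrr.
Qed.

Definition multiplier k : 'M[R]_(r k.+1) :=
  - 2 *: Cmx (mu k) (dual_mx residual k) (Psi k).

(** The first term is the linear part in [W] of the squared norm around the residual, whence the
    factor -2 in [multiplier]. *)
Lemma multiplierP W : L2cores d mu W ->
  2 * L2ip nu (dftt Psi W) residual + \sum_(k < d.-1) \sum_i \sum_j
    multiplier k i j * Cmx (mu k) (W k) (Psi k) i j = 0.
Proof.
move=> LW; pose G k := Cmx (mu k) (Psi k) (W k).
(* The component of [W] along the columns of [Psi], set to 0 at the last core, which the gauge does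
   not constrain. As [W - Z] is gauged, only [Z] pairs with the residual. *)
pose Z : cores R r := fun k y => if (k.+1 < d)%N then Psi k y *m G k else 0.
have Zlt k : (k.+1 < d)%N -> Z k = fun y => Psi k y *m G k.
  by move=> k1d; apply/funext => y; rewrite /Z k1d.
have Zge k : ~~ (k.+1 < d)%N -> Z k = fun=> 0.
  by move=> /negbTE k1d; apply/funext => y; rewrite /Z k1d.
pose W' : cores R r := fun k y => W k y - Z k y.
have LZ : L2cores d mu Z.
  move=> k kd; have [k1d|k1d] := boolP (k.+1 < d)%N.
    by rewrite Zlt//; exact: (L2mx_mulr _ (LPsi kd)).
  move=> i j; rewrite Zge// (_ : (fun _ => _) = fun=> 0); first exact: L20.
  by apply/funext => y; rewrite mxE.
have LW' : L2cores d mu W' by move=> k kd; apply: L2mxB; [exact: LW|exact: LZ].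
have oW' : orthogonal_cores W'.
  move=> k k1d; have kd := ltnW k1d; rewrite -tr_Cmx CmxBr; last 3 first.
  - exact: LPsi.
  - exact: LW.
  - exact: LZ.
  rewrite Zlt// Cmx_mulr; [|exact: LPsi|exact: LPsi].
  by rewrite hPsi// mul1mx subrr trmx0.
have Le := residual_L2.
have -> : L2ip nu (dftt Psi W) residual = L2ip nu (dftt Psi Z) residual.
  have := L2ip_residual LW' oW'.
  rewrite (_ : dftt Psi W' = fun x => dftt Psi W x - dftt Psi Z x); last first.
    by apply/funext => x; exact: dfttB.
  by rewrite L2ipBl ?dftt_L2// => /eqP; rewrite subr_eq0 => /eqP.
(* The sum of the multiplier terms is extended by 0 to the last core, so that the two sums cancel
   term by term. *)
rewrite L2ip_dftt_tr// (big_ord_widen d (fun k => \sum_i \sum_j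
    multiplier k i j * Cmx (mu k) (W k) (Psi k) i j) (leq_pred d)).
rewrite [X in _ + X]big_mkcond/= mulr_sumr -big_split/= big1// => k _.
have LE := dual_mx_L2 Le (ltn_ord k); have LP := LPsi (ltn_ord k).
have -> : (k < d.-1)%N = (k.+1 < d)%N.
  by rewrite -ltnS [X in (_ < X)%N = _](ltn_predK (ltn_ord k)).
case: (boolP (k.+1 < d)%N) => k1d.
  rewrite Zlt// -tr_Cmx mxtrace_tr Cmx_mulr// [X in _ + X](_ : _ =
    - 2 * \tr (Cmx (mu k) (dual_mx residual k) (Psi k) *m G k)).
    by rewrite -mulrDl subrr mul0r.
  rewrite mulr_sumr; apply: eq_bigr => i _; rewrite [in RHS]mxE mulr_sumr.
  apply: eq_bigr => j _; rewrite /multiplier mxE -mulrA; congr (_ * (_ * _)).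
  by rewrite /G -[in RHS]tr_Cmx [RHS]mxE.
rewrite addr0 Zge// tr_CmxE big1 ?mulr0// => a _; rewrite big1// => b _.
rewrite (_ : (fun y => (0 : 'M[R]_(r k, r k.+1)) a b) = fun=> 0) ?L2ip0l//.
by apply/funext => y; rewrite mxE.
Qed.

End Tangent.

(** * Curves of tensors and the action *)

Section Curves.
Context (R : realType) (d : nat) (r : nat -> nat).
Variable mu : nat -> {finite_measure set R -> \bar R}.
Local Notation Omega := (d.-tuple R).
Local Notation nu := (prod_measure d mu).
Implicit Types (Psi W : cores R r) (P : R -> cores R r).

Definition core_derive P Psi W := forall i, (i < d)%N -> forall j l,
  L2curve_derive (mu i) (fun h y => P h i y j l) (fun y => Psi i y j l)
    (fun y => W i y j l).

(** [L2derive] is picked by [xget], with fallback 0. The derivative [g] rules out the fallback and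
    determines the pick almost everywhere. *)
Lemma L2derive_unique d' (T : measurableType d') (m : {measure set T -> \bar R})
    (c : R -> T -> R) s p g :
  (\forall t \near s, c t \in Lfun m 2) -> c s = p %[ae m] ->
  L2curve_derive m (fun h => c (s + h)) p g ->
  [/\ L2derivable m c s, L2derive m c s \in Lfun m 2 & L2derive m c s = g %[ae m]].
Proof.
move=> Lc csp cg; have Lp : p \in Lfun m 2 by case: cg.
have dg := (L2curve_deriveP g Lc csp Lp).2 cg.
have dD : is_L2derive m c s (L2derive m c s).
  by apply: (@xgetPex _ (cst 0) [set g | is_L2derive m c s g]); exists g.
split; [by exists g|by case: dD|].
by have := L2curve_derive_uniq ((L2curve_deriveP _ Lc csp Lp).1 dD) cg.
Qed.

Lemma ae_entry i p q (A B : R -> 'M[R]_(p, q)) j l : A = B %[ae mu i] ->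
  (fun y => A y j l) = (fun y => B y j l) %[ae mu i].
Proof. by apply: filterS => y /= /[apply] ->. Qed.

Lemma L2curve_derive_ae d' (T : measurableType d') (m : {measure set T -> \bar R})
    (p p' : T -> R) : p' = p %[ae m] -> p \in Lfun m 2 -> p' \in Lfun m 2 ->
  L2curve_derive m (fun=> p') p (fun=> 0).
Proof.
move=> pp' Lp Lp'; split => //; first exact: L20.
  by near=> h.
rewrite (_ : (fun _ => _) = fun=> 0); first exact: cvg_cst.
apply/funext => h.
have q0 : L2quot (fun=> p') p (fun=> 0) h = (fun=> 0) %[ae m].
  by apply: filterS pp' => x /= /(_ I) e _; rewrite /L2quot e subrr mulr0 subr0.
have mq : measurable_fun setT (L2quot (fun=> p') p (fun=> 0) h).
  by apply: (@Lfun_measurable _ _ _ m 2); apply: L2quot_L2 => //; exact: L20.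
by rewrite (ae_L2ip q0)// L2ip0l.
Unshelve. all: by end_near. Qed.

(* The constant curve [A] is differentiable in the sense of [L2curve_derive] with
   value [B] at 0, hence so is its image under [ftt]. *)
Lemma ae_ftt (A B : cores R r) : L2cores d mu A -> L2cores d mu B ->
  cores_aeq d mu A B -> ftt A = ftt B %[ae nu].
Proof.
move=> LA LB AB.
have cAB : core_derive (fun=> A) B (fun i y => 0).
  move=> i i_d j l; rewrite (_ : (fun y => (0 : 'M[R]_(r i, r i.+1)) j l) = fun=> 0); last first.
    by apply/funext => y; rewrite mxE.
  by apply: L2curve_derive_ae; [exact: ae_entry (AB i i_d)|exact: LB|exact: LA].
have := L2curve_derive_cvg (L2curve_derive_ftt cAB).
have LAB : (fun x => ftt A x - ftt B x) \in Lfun nu 2.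
  by apply: L2B; exact: ftt_L2.
move=> cv; have {}cv : L2ip nu (fun x => ftt A x - ftt B x)
    (fun x => ftt A x - ftt B x) = 0.
  have cc : (L2ip nu (fun x => ftt A x - ftt B x) (fun x => ftt A x - ftt B x))
      @[h --> (0 : R)^'] --> (L2ip nu (fun x => ftt A x - ftt B x)
        (fun x => ftt A x - ftt B x)) by exact: cvg_cst.
  exact: (cvg_unique (@norm_hausdorff _ R^o) cc cv).
have := L2ip_eq0 LAB cv.
by apply: filterS => x /(_ I) /= /eqP; rewrite subr_eq0 => /eqP.
Qed.

Section Action.
Variables (Psi : cores R r) (LPsi : L2cores d mu Psi) (P : R -> cores R r).
Hypothesis cP : ftt_curve d mu Psi P.

Lemma curve_L2 i j l : (i < d)%N ->
  \forall s \near (0 : R), (fun y => P s i y j l) \in Lfun (mu i) 2.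
Proof. by case: cP => _ _ H i_d; apply: filterS (H i i_d j l) => s []. Qed.

Lemma curve0_L2 : L2cores d mu (P 0).
Proof. by move=> i i_d j l; exact: nbhs_singleton (curve_L2 j l i_d). Qed.

Lemma curve_core_derive : core_derive P Psi (velocity mu P) /\
  L2cores d mu (velocity mu P).
Proof.
case: cP => P0 _ H.
have dP i (i_d : (i < d)%N) j l : is_L2derive (mu i) (fun s y => P s i y j l) 0
    (fun y => velocity mu P i y j l).
  have [_ exg _] := nbhs_singleton (H i i_d j l).
  rewrite (_ : (fun y => _) = L2derive (mu i) (fun s y => P s i y j l) 0); last first.
    by apply/funext => y; rewrite mxE.
  exact: (@xgetPex _ (cst 0) [set g | is_L2derive (mu i) (fun s y => P s i y j l) 0 g]).
split=> i i_d j l; last by case: (dP i i_d j l).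
have := (@L2curve_deriveP _ _ _ (mu i) (fun s y => P s i y j l) 0 (fun y => Psi i y j l) _
  (curve_L2 j l i_d) (ae_entry j l (P0 i i_d)) (LPsi i_d j l)).1 (dP i i_d j l).
by under eq_fun do rewrite add0r.
Qed.

Variable W : cores R r.
Hypothesis cW : core_derive P Psi W.

Lemma velocity_unique i j l : (i < d)%N ->
  (fun y => velocity mu P i y j l) = (fun y => W i y j l) %[ae mu i].
Proof.
move=> i_d; have [cV _] := curve_core_derive.
exact: L2curve_derive_uniq (cV i i_d j l) (cW i_d j l).
Qed.

Lemma gauge_ipE i : (i < d)%N -> gauge_ip mu P i = Cmx (mu i) (W i) (Psi i).
Proof.
move=> i_d; case: cP => P0 _ _; have [_ LV] := curve_core_derive.
apply/matrixP => j l; rewrite !mxE; apply: eq_bigr => m _.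
have Lw : (fun y => W i y m j) \in Lfun (mu i) 2 by case: (cW i_d m j).
have mV := Lfun_measurable (LV i i_d m j).
have mP := Lfun_measurable (curve0_L2 i_d m l).
rewrite (ae_L2ip (velocity_unique m j i_d) mV (Lfun_measurable Lw) mP).
rewrite L2ipC (ae_L2ip (ae_entry m l (P0 i i_d)))//.
- exact: L2ipC.
- exact: Lfun_measurable (LPsi i_d m l).
- exact: Lfun_measurable Lw.
Qed.

(** The action depends on the curve only through its core velocities, known almost everywhere: every
    chosen derivative and the value [P 0] are replaced by [W] and [Psi]. *)
Lemma actionE Nu lam : Nu \in Lfun nu 2 -> action mu Nu lam P =
  L2ip nu (fun x => dftt Psi W x - Nu x) (fun x => dftt Psi W x - Nu x) +
  \sum_(i < d.-1) \sum_(j < r i.+1) \sum_(k < r i.+1)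
      lam i j k * Cmx (mu i) (W i) (Psi i) j k.
Proof.
move=> LNu; case: cP => P0 H _.
have LW : L2cores d mu W by move=> i i_d j l; case: (cW i_d j l).
have Lftt : \forall s \near (0 : R), ftt (P s) \in Lfun nu 2.
  by apply: filterS H => s [].
have cftt : L2curve_derive nu (fun h => ftt (P (0 + h))) (ftt Psi) (dftt Psi W).
  by under eq_fun do rewrite add0r; exact: L2curve_derive_ftt.
have [_ LD aeD] := L2derive_unique Lftt (ae_ftt curve0_L2 LPsi P0) cftt.
have LDN := L2B LD LNu; have LWN := L2B (dftt_L2 LPsi LW) LNu.
rewrite /action L2norm_sqr//; congr (_ + _).
  have ae1 : (fun x => L2derive nu (fun s => ftt (P s)) 0 x - Nu x) =
      (fun x => dftt Psi W x - Nu x) %[ae nu].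
    by apply: filterS aeD => x /= /(_ I) -> _.
  have m1 := Lfun_measurable LDN; have m2 := Lfun_measurable LWN.
  by rewrite (ae_L2ip ae1)// L2ipC (ae_L2ip ae1).
apply: eq_bigr => i _; apply: eq_bigr => j _; apply: eq_bigr => l _.
rewrite gauge_ipE//; apply: leq_trans (ltn_ord i) (leq_pred d).
Qed.

End Action.

(** * A curve of cores with prescribed velocities *)

Section AffineCurve.
Variables (Psi V : cores R r).
Hypotheses (LPsi : L2cores d mu Psi) (LV : L2cores d mu V).
Hypothesis CPsi : forall i, (i < d)%N -> Cmx (mu i) (Psi i) (Psi i) \in unitmx.

Definition affine_curve : R -> cores R r := fun s i y => Psi i y + s *: V i y.

Lemma affine_L2 s : L2cores d mu (affine_curve s).
Proof.
move=> i i_d j l; rewrite (_ : (fun y => _) = fun y => Psi i y j l + s * V i y j l).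
  by apply: L2D; [exact: LPsi|apply: L2Z; exact: LV].
by apply/funext => y; rewrite !mxE.
Qed.

Lemma affine_derive s i j l : (i < d)%N ->
  L2curve_derive (mu i) (fun h y => affine_curve (s + h) i y j l)
    (fun y => affine_curve s i y j l) (fun y => V i y j l).
Proof.
move=> i_d; split; [exact: affine_L2|exact: LV| |].
  by near=> h; exact: affine_L2.
apply: (@cvg0_le _ _ (fun=> 0)); last exact: cvg_cst.
near=> h; have h0 : h != 0 by near: h; exact: nbhs_dnbhs_neq.
rewrite (_ : L2quot _ _ _ h = fun=> 0) ?L2ip0l ?lexx//.
apply/funext => y; rewrite /L2quot !mxE.
by field.
Unshelve. all: by end_near. Qed.

Lemma affine_core_derive : core_derive affine_curve Psi V.
Proof.
move=> i i_d j l; have := affine_derive 0 j l i_d.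
under eq_fun do rewrite add0r.
rewrite (_ : (fun y => affine_curve 0 i y j l) = fun y => Psi i y j l)//.
by apply/funext => y; rewrite /affine_curve scale0r addr0.
Qed.

Lemma Cmx_affine s i : (i < d)%N ->
  Cmx (mu i) (affine_curve s i) (affine_curve s i) =
  Cmx (mu i) (Psi i) (Psi i) + s *: (Cmx (mu i) (Psi i) (V i) +
    Cmx (mu i) (V i) (Psi i)) + (s * s) *: Cmx (mu i) (V i) (V i).
Proof.
move=> i_d; apply/matrixP => j l; rewrite !mxE mulrDr !mulr_sumr -!big_split/=.
apply: eq_bigr => m _.
have L1 k := LPsi i_d m k; have L2 k := LV i_d m k.
have L3 k := L2Z s (L2 k); have L4 k := L2D (L1 k) (L3 k).
rewrite (_ : (fun y => affine_curve s i y m j) = fun y => Psi i y m j + s * V i y m j);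
  last by apply/funext => y; rewrite !mxE.
rewrite (_ : (fun y => affine_curve s i y m l) = fun y => Psi i y m l + s * V i y m l);
  last by apply/funext => y; rewrite !mxE.
rewrite L2ipDl// L2ipZl// L2ipC L2ipDl// L2ipZl//.
rewrite (L2ipC _ (fun y => V i y m j)) L2ipDl// L2ipZl//.
rewrite (L2ipC _ (fun y => Psi i y m l)) (L2ipC _ (fun y => V i y m l)).
rewrite (L2ipC _ (fun y => Psi i y m l)) (L2ipC _ (fun y => V i y m l)).
ring.
Qed.

(** The determinant is a polynomial in [s], nonzero at 0, hence near 0 by continuity. This keeps the
    affine curve within the cores with invertible Gram matrix. *)
Lemma near_unitmx n (A B C : 'M[R]_n) : A \in unitmx ->
  \forall s \near (0 : R), A + s *: B + (s * s) *: C \in unitmx.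
Proof.
move=> uA.
pose M : 'M[{poly R}]_n := \matrix_(i, j)
  ((A i j)%:P + 'X * (B i j)%:P + 'X * 'X * (C i j)%:P).
have fE s : A + s *: B + (s * s) *: C = map_mx (horner_eval s) M.
  by apply/matrixP => i j; rewrite !mxE /horner_eval !hornerE.
have : \forall s \near (0 : R), (\det M).[s] != 0.
  apply: (cvgr_neq0 _ (@continuous_horner R (\det M) 0)).
  rewrite -[_.[_]]/(horner_eval 0 (\det M)) -det_map_mx -fE.
  by rewrite scale0r mul0r scale0r !addr0 -unitfE.
apply: filterS => s Ms; rewrite unitmxE unitfE fE det_map_mx.
exact: Ms.
Qed.

Lemma affine_ftt_curve : ftt_curve d mu Psi affine_curve.
Proof.
split.
- move=> i i_d; apply: aeW => y _; rewrite /affine_curve scale0r addr0//.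
- have : \forall s \near (0 : R), forall i : 'I_d,
      Cmx (mu i) (affine_curve s i) (affine_curve s i) \in unitmx.
    have u (i : 'I_d) : \forall s \near (0 : R),
        Cmx (mu i) (affine_curve s i) (affine_curve s i) \in unitmx.
      have := near_unitmx (Cmx (mu i) (Psi i) (V i) + Cmx (mu i) (V i) (Psi i))
        (Cmx (mu i) (V i) (V i)) (CPsi (ltn_ord i)).
      by apply: filterS => s; rewrite -Cmx_affine.
    exact: (filter_forall _ u).
  apply: filterS => s us; split.
  + exact: (ftt_L2 (affine_L2 s)).
  + move=> i i_d; split; last exact: (us (Ordinal i_d)).
    exact: affine_L2.
  + exact: ae_eq_refl.
- move=> i i_d j l; near=> s.
  have LA (t : R) : \forall s \near t, (fun y => affine_curve s i y j l) \in Lfun (mu i) 2.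
    by near=> s'; exact: affine_L2.
  (* At every [t] the derivative is the same [V] almost everywhere, so its continuity reduces to
     that of a constant. *)
  have dc t := @L2derive_unique _ _ (mu i) (fun s y => affine_curve s i y j l) t
    (fun y => affine_curve t i y j l) (fun y => V i y j l)
    (LA t) (ae_eq_refl _ _ _)
    (affine_derive t j l i_d).
  have [ds Ls aes] := dc s.
  split=> //; first exact: affine_L2.
  rewrite (_ : (fun t => _) = fun=> 0%E); first exact: cvg_cst.
  apply/funext => t; have [_ Lt aet] := dc t.
  have Lts := L2B Lt Ls; rewrite (LnormE Lts).
  have ae0 : (fun y => L2derive (mu i) (fun s y => affine_curve s i y j l) t y -
     L2derive (mu i) (fun s y => affine_curve s i y j l) s y) = (fun=> 0) %[ae mu i].
    by apply: filterS2 aes aet => y /= /(_ I) e1 /(_ I) e2 _; rewrite e1 e2 subrr.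
  by rewrite (ae_L2ip ae0) ?L2ip0l ?sqrtr0//; exact: Lfun_measurable Lts.
Unshelve. all: by end_near. Qed.

End AffineCurve.
End Curves.

(** * Comparison of velocities and the equations of the system *)

Section Minimum.
Context (R : realType) (d : nat) (r : nat -> nat).
Variable mu : nat -> {finite_measure set R -> \bar R}.
Local Notation Omega := (d.-tuple R).
Local Notation nu := (prod_measure d mu).
Variables (Psi : cores R r) (Nu : Omega -> R).
Hypotheses (hd : (1 < d)%N) (hr0 : r 0%N = 1%N) (hrd : r d = 1%N).
Hypothesis LPsi : L2cores d mu Psi.
Hypothesis hPsi : forall i, (i.+1 < d)%N -> Cmx (mu i) (Psi i) (Psi i) = 1%:M.
Hypothesis hPhi : forall k, (0 < k < d)%N -> forall x : Omega,
  CPhi mu Psi k x \in unitmx.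
Hypothesis LNu : Nu \in Lfun nu 2.
Local Notation V := (pde_velocity mu Psi Nu).
Local Notation e := (residual mu Psi Nu).

(** Linearity gives [D W - Nu = e + D (W - V)]. The cross term is kept for arbitrary [W]: it
    vanishes under the gauge, and the multipliers compensate it otherwise. *)
Lemma L2ip_residual_shift (W : cores R r) : L2cores d mu W ->
  L2ip nu (fun x => dftt Psi W x - Nu x) (fun x => dftt Psi W x - Nu x) =
  L2ip nu e e + 2 * L2ip nu (dftt Psi (fun k y => W k y - V k y)) e +
  L2ip nu (dftt Psi (fun k y => W k y - V k y)) (dftt Psi (fun k y => W k y - V k y)).
Proof.
move=> LW; have LV := pde_velocity_L2 hr0 LPsi hPsi LNu.
set U : cores R r := fun k y => W k y - V k y.
have LU : L2cores d mu U by move=> k kd; apply: L2mxB; [exact: LW|exact: LV].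
have Le := residual_L2 hr0 LPsi hPsi LNu.
have LDU := dftt_L2 LPsi LU.
rewrite (_ : (fun x => dftt Psi W x - Nu x) = fun x => e x + dftt Psi U x); last first.
  by apply/funext => x; rewrite /U dfttB /residual; ring.
have LeU := L2D Le LDU.
rewrite (L2ipDl Le LDU LeU) (L2ipC nu e) (L2ipDl Le LDU Le).
rewrite (L2ipC nu (dftt Psi U) (fun x => e x + _)) (L2ipDl Le LDU LDU).
rewrite (L2ipC nu e (dftt Psi U)); ring.
Qed.

Lemma pair_lr_dual_mx k (x : Omega) : (k < d)%N ->
  pair_lr mu Nu Psi k k.+1 x = dual_mx mu Psi Nu k x`_k.
Proof.
move=> kd; apply/matrixP => a b; rewrite [RHS]mxE.
exact: pair_lr_coord.
Qed.

Lemma pde_velocityE k (x : Omega) : (k.+1 < d)%N -> V k x`_k =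
  (pair_lr mu Nu Psi k k.+1 x - Psi k x`_k *m pair_lr mu Nu Psi k.+1 k.+1 x)
    *m invmx (CPhi mu Psi k.+1 x).
Proof.
move=> k1d; have kd := ltnW k1d.
rewrite pde_velocity_lt// (Cmx_dual_mx LPsi x LNu kd) pair_lr_dual_mx//.
by rewrite (right_gramE hrd LPsi x kd).
Qed.

(** Brings the first equation into the shape of the middle ones: the empty left product is 1, and
    the inner partial integral runs over no variable. *)
Lemma pair_lr0 (x : Omega) : pair_lr mu Nu Psi 0 1 x =
  pintmx mu (fun i => (1 <= i)%N)
    (fun z => const_mx (Nu z) : 'M[R]_(r 0%N, r d)) (fun z => (Phi Psi 1 z)^T) x.
Proof.
have mNu := Lfun_measurable LNu.
apply/matrixP => a b; rewrite pair_lrE mxE; congr (pint mu _ _ x).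
apply/funext => z; rewrite pint_none//; last first.
  by under eq_fun do rewrite lrow0 mul1r.
rewrite lrow0 mul1r mxE /rcol mulr_sumr; apply: eq_bigr => j _.
by rewrite !mxE.
Qed.

(** Here the right product is empty and the outer partial integral runs over no variable. *)
Lemma pair_lr_last k (x : Omega) : k.+1 = d -> pair_lr mu Nu Psi k k.+1 x =
  pintmx mu (fun i => (i < k)%N) (fun z => (lprod Psi k z)^T)
    (fun z => const_mx (Nu z) : 'M[R]_(r 0%N, r k.+1)) x.
Proof.
move=> kd; have k_d : (k <= d)%N by rewrite -kd.
apply/matrixP => a b; rewrite pair_lrE [RHS]mxE.
rewrite (_ : (fun z => pint mu _ _ z * _) =
    pint mu (fun i => (i < k)%N) (fun y => lrow Psi a y * Nu y)); last first.
  by apply/funext => z; rewrite rcol_last// mulr1.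
rewrite pint_none; last 2 first.
- exact: left_pint_measurable.
- by move=> i; rewrite -kd ltnS leqNgt => /negbTE.
congr (pint mu _ _ x); apply/funext => z; rewrite mxE /lrow mulr_suml.
by apply: eq_bigr => i _; rewrite !mxE.
Qed.

Lemma pde_velocity_system (W : cores R r) :
  (forall i, (i < d)%N -> W i = V i %[ae mu i]) -> pde_system mu Nu Psi W.
Proof.
move=> WV; split.
- have := WV 0%N (ltnW hd); apply: filterS => y /(_ I) -> x <-.
  by rewrite -pair_lr0; exact: (pde_velocityE x hd).
- move=> k k0 k1d; have := WV k (ltnW k1d); apply: filterS => y /(_ I) -> x <-.
  exact: pde_velocityE.
- have dE : d.-1.+1 = d by exact: ltn_predK hd.
  have d1d : (d.-1 < d)%N by rewrite -[X in (_ < X)%N]dE.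
  have := WV d.-1 d1d; apply: filterS => y /(_ I) -> x <-.
  by rewrite pde_velocity_last// -pair_lr_last// pair_lr_dual_mx.
Qed.

(** As [V] is gauged, the multiplier terms do not distinguish [W] from [W - V]. *)
Lemma Cmx_velocity_shift (W : cores R r) k : L2cores d mu W -> (k.+1 < d)%N ->
  Cmx (mu k) (fun y => W k y - V k y) (Psi k) = Cmx (mu k) (W k) (Psi k).
Proof.
move=> LW k1d; have kd := ltnW k1d; have LV := pde_velocity_L2 hr0 LPsi hPsi LNu.
rewrite -[LHS]tr_Cmx CmxBr; [|exact: LPsi|exact: LW|exact: LV].
rewrite raddfB/= !tr_Cmx (pde_velocity_orthogonal hr0 LPsi hPsi LNu k1d).
by rewrite subr0.
Qed.

End Minimum.

Lemma ae_mx (R : realType) (m : {measure set R -> \bar R}) p q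
    (A B : R -> 'M[R]_(p, q)) :
  (forall j l, (fun y => A y j l) = (fun y => B y j l) %[ae m]) -> A = B %[ae m].
Proof.
move=> AB; have : \forall y \ae m, forall jl : 'I_p * 'I_q, A y jl.1 jl.2 = B y jl.1 jl.2.
  by apply: filter_forall => -[j l]; apply: filterS (AB j l) => y /(_ I).
by apply: filterS => y AB' _; apply/matrixP => j l; exact: (AB' (j, l)).
Qed.

(** Under the gauge the multiplier terms vanish, which gives the comparison for every [lam], with
    uniqueness of the velocities; curves that violate the gauge are compared for the particular
    [lam] given by [multiplier]. *)
Theorem theorem4p1 (R : realType) (d : nat) (hd : (1 < d)%N)
    (a b : nat -> R) (hab : forall i, (i < d)%N -> a i <= b i)
    (mu : nat -> {finite_measure set R -> \bar R})
    (hmu : forall i, (i < d)%N -> mu i (~` `[a i, b i]) = 0%E)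
    (r : nat -> nat) (hr0 : r 0%N = 1%N) (hrd : r d = 1%N)
    (hr : forall i, (i <= d)%N -> (0 < r i)%N)
    (N : (d.-tuple R -> R) -> d.-tuple R -> R)
    (u : d.-tuple R -> R) (Psi : cores R r)
    (hu : ftt_decomp mu u Psi)
    (hPsi : forall i, (i.+1 < d)%N -> Cmx (mu i) (Psi i) (Psi i) = 1%:M)
    (hPhi : forall k, (0 < k < d)%N -> forall x : d.-tuple R,
       CPhi mu Psi k x \in unitmx)
    (hN : N u \in Lfun (prod_measure d mu) 2) :
  exists Q : R -> cores R r,
    [/\ ftt_curve d mu Psi Q,
        gauge d mu Q,
        (forall (lam : forall i : nat, 'M[R]_(r i.+1)) (P : R -> cores R r),
           ftt_curve d mu Psi P -> gauge d mu P ->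
           action mu (N u) lam Q <= action mu (N u) lam P /\
           (action mu (N u) lam P = action mu (N u) lam Q ->
            cores_aeq d mu (velocity mu P) (velocity mu Q))),
        (exists lam : forall i : nat, 'M[R]_(r i.+1),
           forall P : R -> cores R r, ftt_curve d mu Psi P ->
           action mu (N u) lam Q <= action mu (N u) lam P) &
        pde_system mu (N u) Psi (velocity mu Q)].
Proof.
have [_ hc _] := hu.
have LPsi : L2cores d mu Psi by move=> i i_d; case: (hc i i_d).
have CU i : (i < d)%N -> Cmx (mu i) (Psi i) (Psi i) \in unitmx.
  by move=> i_d; case: (hc i i_d).
have lt1d (i : 'I_d.-1) : (i.+1 < d)%N.
  by have := ltn_ord i; rewrite -ltnS [X in (_ < X)%N](ltn_predK hd).
pose V := pde_velocity mu Psi (N u).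
have LV : L2cores d mu V := pde_velocity_L2 hr0 LPsi hPsi hN.
have oV : orthogonal_cores d mu Psi V := pde_velocity_orthogonal hr0 LPsi hPsi hN.
have cQ := affine_ftt_curve LPsi LV CU.
have dQ := affine_core_derive LPsi LV.
have aQ lam : action mu (N u) lam (affine_curve Psi V) =
    L2ip (prod_measure d mu) (residual mu Psi (N u)) (residual mu Psi (N u)).
  rewrite (actionE LPsi cQ dQ lam hN) [X in _ + X]big1 ?addr0// => i _.
  apply: big1 => j _; apply: big1 => l _.
  by rewrite (oV i (lt1d i)) [X in _ * X]mxE mulr0.
have velQ i : (i < d)%N -> velocity mu (affine_curve Psi V) i = V i %[ae mu i].
  by move=> i_d; apply: ae_mx => j l; exact: (velocity_unique LPsi cQ dQ).
have LU W : L2cores d mu W -> L2cores d mu (fun k y => W k y - V k y).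
  by move=> LW k kd; apply: L2mxB; [exact: LW|exact: LV].
exists (affine_curve Psi V); split => //.
- by move=> i i1d j l; rewrite (gauge_ipE LPsi cQ dQ (ltnW i1d)) oV// mxE.
- move=> lam P cP gP.
  have [dP LW] := curve_core_derive LPsi cP.
  have oW : orthogonal_cores d mu Psi (velocity mu P).
    move=> k k1d; rewrite -(gauge_ipE LPsi cP dP (ltnW k1d)).
    by apply/matrixP => i j; rewrite gP// mxE.
  have oU : orthogonal_cores d mu Psi (fun k y => velocity mu P k y - V k y).
    by move=> k k1d; rewrite (Cmx_velocity_shift hr0 LPsi hPsi hN)// oW.
  have LUP := LU _ LW.
  rewrite aQ (actionE LPsi cP dP lam hN) [X in _ + X]big1 ?addr0; last first.
    move=> i _; apply: big1 => j _; apply: big1 => l _.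
    by rewrite (oW i (lt1d i)) [X in _ * X]mxE mulr0.
  rewrite (L2ip_residual_shift hr0 LPsi hPsi hN LW).
  rewrite (L2ip_residual hr0 hrd LPsi hPsi hPhi hN LUP oU) mulr0 addr0.
  split; first by rewrite lerDl L2ip_ge0.
  (* Equality of the actions leaves [|D (W - V)|^2 = 0], and [D] is definite on gauged
     velocities. *)
  move=> /eqP; rewrite -subr_eq0 addrAC subrr add0r => /eqP U0 i i_d.
  apply: ae_eq_trans (ae_eq_sym (velQ i i_d)); apply: ae_mx => j l.
  have := dftt_definite hr0 hrd LPsi hPsi hPhi LUP oU U0 i_d j l.
  apply: filterS => y /(_ I) /=; rewrite mxE [X in _ + X]mxE => /eqP.
  by rewrite subr_eq0 => /eqP.
- exists (multiplier mu Psi (N u)) => P cP.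
  have [dP LW] := curve_core_derive LPsi cP.
  have LUP := LU _ LW.
  rewrite aQ (actionE LPsi cP dP _ hN) (L2ip_residual_shift hr0 LPsi hPsi hN LW).
  (* Applied to [W - V], this cancels the cross term against the multiplier terms of [W] itself. *)
  have := multiplierP hr0 hrd LPsi hPsi hPhi hN LUP.
  under [X in _ + X]eq_bigr => i _ do
    rewrite (Cmx_velocity_shift hr0 LPsi hPsi hN LW (lt1d i)).
  move=> m0; rewrite addrAC -[X in X + _]addrA m0.
  by rewrite addr0 lerDl L2ip_ge0.
- exact: pde_velocity_system.
Qed.
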